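(* Let $m=n=2$ and let $u$ be the flip permutation matrix in $M_4(\mathbb{C})$, i.e. $u_{(i,j),(i',j')}=1$ if $(i',j')=(j,i)$ and $0$ otherwise, so that the commutation relations are $e_if_j=f_ie_j$ for $1\le i,j\le2$. Then the tensor algebra $\mathcal{T}_+(X_u)$ and the algebra $\mathcal{A}_u$ are not isometrically isomorphic (there is no isometric algebra isomorphism from $\mathcal{A}_u$ onto $\mathcal{T}_+(X_u)$).
   Context: For this $u$, let $\mathbb{F}_\theta^+$ be the unital semigroup generated by $e_1,e_2,f_1,f_2$ subject only to $e_if_j=f_ie_j$ ($1\le i,j\le 2$). The algebra $\mathcal{A}_u$ is the norm closed unital operator algebra on $\ell^2(\mathbb{F}_\theta^+)$ generated by the left regular representation $\lambda(w)\xi_x=\xi_{wx}$, $w\in\mathbb{F}_\theta^+$. A row contractive representation is a pair of row contractions $A=[A_1\ A_2]$, $B=[B_1\ B_2]$ of operators on a Hilbert space $\mathcal{H}$ (each a contraction $\mathcal{H}^2\to\mathcal{H}$) satisfying $A_iB_j=B_iA_j$ for all $i,j$; it determines a unital representation $\pi_{A,B}$ of the semigroup algebra $\mathbb{C}[\mathbb{F}_\theta^+]$ with $e_i\mapsto A_i$, $f_j\mapsto B_j$. The tensor algebra $\mathcal{T}_+(X_u)$ is the universal operator algebra for the family of row contractive representations: the completion of $\mathbb{C}[\mathbb{F}_\theta^+]$ in the norm $\|x\|=\sup_{A,B}\|\pi_{A,B}(x)\|$ (with the analogous matrix norms), the supremum being over all row contractive representations. *)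

(* Defs.v *)
From HB Require Import structures.
From mathcomp Require Import all_boot all_order all_algebra finmap.
From mathcomp Require Import all_classical all_reals.
From mathcomp Require Import ereal topology normedtype sequences esum.
From mathcomp Require Import complex ring lra.
From mathcomp Require monalg.
(* The notations of monalg clash with those of the analysis library. *)
Import -(notations) monalg.

Set Implicit Arguments.
Unset Strict Implicit.
Unset Printing Implicit Defensive.

Import Order.TTheory GRing.Theory Num.Theory.
Import numFieldNormedType.Exports.

Local Open Scope classical_set_scope.
Local Open Scope ring_scope.

(** * The semigroup generated by e_1, e_2, f_1, f_2 with e_i f_j = f_i e_j *)

Definition letter := ('I_2 + 'I_2)%type.
Definition e_ (i : 'I_2) : letter := inl i.
Definition f_ (j : 'I_2) : letter := inr j.

Inductive flip_cong : seq letter -> seq letter -> Prop :=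
| flip_rel i j : flip_cong [:: e_ i; f_ j] [:: f_ i; e_ j]
| flip_refl u : flip_cong u u
| flip_sym u v : flip_cong u v -> flip_cong v u
| flip_trans u v w : flip_cong u v -> flip_cong v w -> flip_cong u w
| flip_cat u u' v v' :
    flip_cong u u' -> flip_cong v v' -> flip_cong (u ++ v) (u' ++ v').

Definition flip_rel_bool (u v : seq letter) : bool := `[< flip_cong u v >].

Lemma flip_rel_equiv : equiv_class_of flip_rel_bool.
Proof.
split=> [u|u v|v u w]; first exact/asboolP/flip_refl.
  by apply/asboolP/asboolP; exact: flip_sym.
by move=> /asboolP uv /asboolP vw; apply/asboolP/(flip_trans uv vw).
Qed.

Canonical flip_equiv := EquivRelPack flip_rel_equiv.

Definition Ftheta : Type := {eq_quot flip_equiv}%qT.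
HB.instance Definition _ := Choice.on Ftheta.
HB.instance Definition _ := EqQuotient.on Ftheta.

Definition cls (u : seq letter) : Ftheta := (\pi u)%qT.

Lemma clsP u v : cls u = cls v <-> flip_cong u v.
Proof.
split=> [/eqP|h]; first by rewrite /cls piE => /asboolP.
by apply/eqP; rewrite /cls piE; apply/asboolP.
Qed.

Lemma repr_cls u : flip_cong (repr (cls u)) u.
Proof. by apply/clsP; rewrite /cls reprK. Qed.

Lemma cls_repr x : cls (repr x) = x.
Proof. by rewrite /cls reprK. Qed.

Definition mulF (x y : Ftheta) : Ftheta := cls (repr x ++ repr y).

Lemma mulF_cls u v : mulF (cls u) (cls v) = cls (u ++ v).
Proof. by apply/clsP/flip_cat; exact: repr_cls. Qed.

Lemma mulFA : associative mulF.
Proof.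
move=> x y z; rewrite -[x]cls_repr -[y]cls_repr -[z]cls_repr.
by rewrite !mulF_cls catA.
Qed.

Lemma mul1F : left_id (cls [::]) mulF.
Proof. by move=> x; rewrite -[x]cls_repr mulF_cls. Qed.

Lemma mulF1 : right_id (cls [::]) mulF.
Proof. by move=> x; rewrite -[x]cls_repr mulF_cls cats0. Qed.

Lemma flip_cong_size u v : flip_cong u v -> size u = size v.
Proof. elim=> //= [{}u {}v w _ -> _ ->|{}u u' {}v v' _ uu' _ vv'] //.
by rewrite !size_cat uu' vv'. Qed.

Lemma mulF_unit x y : mulF x y = cls [::] -> x = cls [::] /\ y = cls [::].
Proof.
rewrite -[x]cls_repr -[y]cls_repr mulF_cls => /clsP/flip_cong_size.
by rewrite size_cat; case: (repr x) (repr y) => [|? ?] [|? ?].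
Qed.

HB.instance Definition _ := monalg.Choice_isMonomialDef.Build Ftheta
  mulFA mul1F mulF1 mulF_unit.

Definition letter_idx (l : letter) : 'I_2 :=
  match l with inl i => i | inr j => j end.

Definition is_e (l : letter) : bool := if l is inl _ then true else false.

Definition nform (k : nat) (s : seq 'I_2) : seq letter :=
  map e_ (take k s) ++ map f_ (drop k s).

Lemma nform_f k s i :
  (k <= size s)%N -> flip_cong (f_ i :: nform k s) (nform k (i :: s)).
Proof.
elim: k s i => [|k IHk] s i; first by rewrite /nform !take0 !drop0; constructor.
case: s => [//|j s] /= ks; apply: (@flip_trans _ (e_ i :: f_ j :: nform k s)).
  apply: (@flip_cat [:: _; _] [:: _; _]); last exact: flip_refl.
  exact/flip_sym/flip_rel.
by apply: (@flip_cat [:: _] [:: _]); [exact: flip_refl|exact: IHk].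
Qed.

Lemma flip_nform u : flip_cong u (nform (count is_e u) (map letter_idx u)).
Proof.
elim: u => [|l u IHu] /=; first exact: flip_refl.
apply: (@flip_trans _ (l :: nform (count is_e u) (map letter_idx u))).
  by apply: (@flip_cat [:: _] [:: _]); [exact: flip_refl|exact: IHu].
case: l => i /=; first exact: flip_refl.
by apply: nform_f; rewrite size_map count_size.
Qed.

Lemma flip_congP u v : flip_cong u v <->
  count is_e u = count is_e v /\ map letter_idx u = map letter_idx v.
Proof.
split=> [|[eqc eqi]]; last first.
  apply: flip_trans (flip_nform u) _; rewrite eqc eqi.
  exact/flip_sym/flip_nform.
elim=> // [{}u {}v _ [-> ->]|{}u {}v w _ [-> ->]
  |{}u u' {}v v' _ [uc ui] _ [vc vi]] //.
by rewrite !count_cat !map_cat uc ui vc vi.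
Qed.

Lemma mulFI x : injective (mulF x).
Proof.
move=> y z; rewrite -[x]cls_repr -[y]cls_repr -[z]cls_repr !mulF_cls.
move=> /clsP/flip_congP []; rewrite !count_cat !map_cat => /addnI yzc.
move=> /eqP; rewrite eqseq_cat // eqxx /= => /eqP yzi.
exact/clsP/flip_congP.
Qed.

(** * Hilbert spaces and bounded operators *)

Definition cauchy_seq (R : realType) (V : zmodType) (nu : V -> R)
    (u : nat -> V) : Prop :=
  forall e : R, 0 < e -> exists N : nat, forall i j : nat,
    (N <= i)%N -> (N <= j)%N -> nu (u i - u j) < e.

Definition norm_cvg (R : realType) (V : zmodType) (nu : V -> R)
    (u : nat -> V) (l : V) : Prop :=
  (fun n => nu (u n - l)) @ \oo --> (0 : R).

Definition dot_norm (R : realType) (V : lmodType R[i])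
    (form : {dot V for Num.conj}) (x : V) : R :=
  Num.sqrt (complex.Re (form x x)).

Record hilbertSpace (R : realType) := HilbertSpace {
  hcarrier :> lmodType R[i];
  hdot : {dot hcarrier for Num.conj};
  hcomplete : forall u : nat -> hcarrier,
    cauchy_seq (dot_norm hdot) u -> exists l, norm_cvg (dot_norm hdot) u l }.

Definition hnorm (R : realType) (H : hilbertSpace R) : H -> R :=
  dot_norm (hdot H).

Section Operators.
Variables (R : realType) (V : lmodType R[i]) (nu : V -> R).

Definition bounded_op (T : V -> V) : Prop :=
  linear T /\ exists M : R, forall x, nu (T x) <= M * nu x.

(* Meaningful for bounded operators only. *)
Definition opnorm (T : V -> V) : R :=
  sup [set nu (T x) | x in [set x | nu x <= 1]].

End Operators.

Lemma normc_ge0 (R : realType) (c : R[i]) : 0 <= Normc.normc c.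
Proof. by case: c => a b; exact: sqrtr_ge0. Qed.

Section HilbertTheory.
Variables (R : realType) (H : hilbertSpace R).
Implicit Types (x y : H) (c : R[i]) (T : H -> H).
Local Notation "'[ x , y ]" := (hdot H x y).

Lemma hdot_ge0 x : 0 <= '[x, x].
Proof. exact: dnorm_ge0. Qed.

Lemma hnorm_sqr x : hnorm x ^+ 2 = complex.Re '[x, x].
Proof.
have := hdot_ge0 x; rewrite lecE /= => /andP[_ re0].
by rewrite /hnorm /dot_norm sqr_sqrtr.
Qed.

Lemma hdot_im x : complex.Im '[x, x] = 0.
Proof. by have := hdot_ge0 x; rewrite lecE /= => /andP[/eqP]. Qed.

Lemma hnorm_ge0 x : 0 <= hnorm x.
Proof. exact: sqrtr_ge0. Qed.

Lemma hnorm0 : hnorm (0 : H) = 0.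
Proof. by rewrite /hnorm /dot_norm linear0r /= sqrtr0. Qed.

Lemma hnorm_eq0 x : hnorm x = 0 -> x = 0.
Proof.
move=> x0; apply/eqP; rewrite -(dnorm_eq0 (hdot H)) eq_complex hdot_im.
by rewrite -hnorm_sqr x0 expr0n !eqxx.
Qed.

Lemma hnormZ c x : hnorm (c *: x) = Normc.normc c * hnorm x.
Proof.
apply/eqP; rewrite -(@eqrXn2 _ 2) ?hnorm_ge0 ?mulr_ge0 ?hnorm_ge0 ?normc_ge0 //.
rewrite hnorm_sqr exprMn hnorm_sqr dnormZ.
have -> : `|c| = Complex (Normc.normc c) 0 by [].
have := hdot_im x; case: ('[x, x]) => a b /= ->.
by move: (Normc.normc c) => r; rewrite !expr2; simpc.
Qed.

Lemma hnormD_sqr x y :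
  hnorm (x + y) ^+ 2 = hnorm x ^+ 2 + hnorm y ^+ 2 + complex.Re '[x, y] *+ 2.
Proof.
rewrite !hnorm_sqr dnormD.
case: ('[x, x]) => a b; case: ('[y, y]) => a' b'; case: ('[x, y]) => a'' b''.
by rewrite mulr2n.
Qed.

Lemma re_hdot_le x y : complex.Re '[x, y] <= hnorm x * hnorm y.
Proof.
have [x0|x0] := eqVneq (hnorm x) 0.
  by rewrite (hnorm_eq0 x0) linear0l hnorm0 mul0r.
have [y0|y0] := eqVneq (hnorm y) 0.
  by rewrite (hnorm_eq0 y0) linear0r hnorm0 mulr0.
have xy0 : 0 < hnorm x * hnorm y by rewrite mulr_gt0 // lt_def ?x0 ?y0 hnorm_ge0.
have := sqr_ge0 (hnorm (Complex (hnorm y) 0 *: x + Complex (- hnorm x) 0 *: y)).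
rewrite hnormD_sqr !hnormZ linearZl_LR linearZr_LR /= expr0n !addr0 !sqrtr_sqr.
rewrite normrN !ger0_norm ?hnorm_ge0 //.
case: ('[x, y]) => a b; simpc => /=.
move: xy0; set p := hnorm x; set q := hnorm y => pq0 h.
rewrite -(ler_pM2l pq0); nra.
Qed.

Lemma hnormD x y : hnorm (x + y) <= hnorm x + hnorm y.
Proof.
rewrite -(@ler_pXn2r _ 2) ?nnegrE ?addr_ge0 ?hnorm_ge0 //.
rewrite hnormD_sqr sqrrD addrAC lerD2r lerD2l.
by rewrite lerMn2r re_hdot_le orbT.
Qed.

Lemma opnorm_le T M : 0 <= M -> (forall x, hnorm (T x) <= M * hnorm x) ->
  opnorm (@hnorm R H) T <= M.
Proof.
move=> M0 TM; apply: ge_sup.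
  by exists (hnorm (T 0)), 0 => //=; rewrite hnorm0.
move=> _ [x /= x1 <-]; apply: le_trans (TM x) _.
by rewrite -[leRHS]mulr1 ler_wpM2l.
Qed.

Lemma opnorm_ge T x : bounded_op (@hnorm R H) T -> hnorm x <= 1 ->
  hnorm (T x) <= opnorm (@hnorm R H) T.
Proof.
move=> [_ [M TM]] x1; apply: ub_le_sup; last by exists x.
exists `|M| => _ [y /= y1 <-]; apply: le_trans (TM y) _.
apply: le_trans (_ : `|M| * hnorm y <= _).
  by rewrite ler_wpM2r ?hnorm_ge0 // ler_norm.
by rewrite -[leRHS]mulr1 ler_wpM2l.
Qed.

Lemma opnorm_ge0 T : bounded_op (@hnorm R H) T -> 0 <= opnorm (@hnorm R H) T.
Proof.
by move=> bT; apply: le_trans (opnorm_ge bT (x := 0) _); rewrite ?hnorm_ge0 ?hnorm0.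
Qed.

Lemma opnormP T x : bounded_op (@hnorm R H) T ->
  hnorm (T x) <= opnorm (@hnorm R H) T * hnorm x.
Proof.
move=> bT; have [linT _] := bT.
have T0 : T 0 = 0.
  have /eqP := linT 1 0 0.
  by rewrite !scale1r addr0 -subr_eq0 opprD addrA subrr add0r oppr_eq0 => /eqP.
have TZ c y : T (c *: y) = c *: T y by rewrite -[c *: y]addr0 linT T0 addr0.
have [x0|x0] := eqVneq (hnorm x) 0.
  by rewrite (hnorm_eq0 x0) T0 !hnorm0 mulr0.
have xgt0 : 0 < hnorm x by rewrite lt_def x0 hnorm_ge0.
have cE : Normc.normc (Complex (hnorm x)^-1 0) = (hnorm x)^-1.
  by rewrite /= expr0n addr0 sqrtr_sqr ger0_norm // invr_ge0 ltW.
have := opnorm_ge (x := Complex (hnorm x)^-1 0 *: x) bT.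
rewrite TZ !hnormZ cE mulVf // => /(_ (lexx _)).
by rewrite mulrC ler_pdivrMr.
Qed.

End HilbertTheory.

(** * Row contractive representations and the universal norm *)

Section Representations.
Variables (R : realType) (H : hilbertSpace R).

(* [T_1 T_2] is a contraction from the Hilbert space sum of two copies of H
   to H. *)
Definition row_contraction (T : 'I_2 -> {linear H -> H}) : Prop :=
  forall x : 'I_2 -> H,
    hnorm (\sum_i T i (x i)) ^+ 2 <= \sum_i hnorm (x i) ^+ 2.

Definition row_contractive_rep (A B : 'I_2 -> {linear H -> H}) : Prop :=
  [/\ row_contraction A, row_contraction B
    & forall i j h, A i (B j h) = B i (A j h)].

Variables A B : 'I_2 -> {linear H -> H}.

Definition letter_op (l : letter) : {linear H -> H} :=
  match l with inl i => A i | inr j => B j end.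

Definition word_op (u : seq letter) : H -> H :=
  foldr (fun l T => letter_op l \o T) idfun u.

(* Independent of the representing words by [word_op_cong] below. *)
Definition pi_rep (x : malg Ftheta R[i]) : H -> H :=
  fun h => \sum_(w <- msupp x) mcoeff w x *: word_op (repr w) h.

End Representations.

Definition univ_norm (R : realType) (x : malg Ftheta R[i]) : R :=
  sup [set r | exists (H : hilbertSpace R) (A B : 'I_2 -> {linear H -> H}),
    row_contractive_rep A B /\ r = opnorm (@hnorm R H) (pi_rep A B x)].

Section RepresentationTheory.
Variables (R : realType) (H : hilbertSpace R) (A B : 'I_2 -> {linear H -> H}).
Hypothesis AB : row_contractive_rep A B.
Implicit Types (x y : malg Ftheta R[i]) (u v : seq letter) (h : H).

Lemma row_contraction_le (T : 'I_2 -> {linear H -> H}) i h :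
  row_contraction T -> hnorm (T i h) <= hnorm h.
Proof.
move=> /(_ (fun k => if k == i then h else 0)).
rewrite (bigD1 i) //= eqxx big1 => [|k /negbTE ->]; last by rewrite linear0.
rewrite (bigD1 i) //= eqxx big1 => [|k /negbTE ->]; last by rewrite hnorm0 expr0n.
by rewrite !addr0 ler_pXn2r ?nnegrE ?hnorm_ge0.
Qed.

Lemma word_op_cat u v h :
  word_op A B (u ++ v) h = word_op A B u (word_op A B v h).
Proof. by elim: u => //= l u ->. Qed.

Lemma word_op_cong u v h : flip_cong u v -> word_op A B u h = word_op A B v h.
Proof.
move=> uv; elim: uv h => //= [i j|{}u {}v w _ uv _ vw
  |{}u u' {}v v' _ uu' _ vv'] h.
- by case: AB => _ _ ->.
- by rewrite uv.
- by rewrite !word_op_cat uu' vv'.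
Qed.

Lemma word_op_linear u : linear (word_op A B u).
Proof. by elim: u => //= l u IHu a h h'; rewrite /= IHu linearP. Qed.

Lemma word_op_le u h : hnorm (word_op A B u h) <= hnorm h.
Proof.
elim: u => //= l u; apply: le_trans.
by case: AB => cA cB _; case: l => i /=; exact: row_contraction_le.
Qed.

Lemma pi_repEw (d : {fset Ftheta}) x h : (msupp x `<=` d)%fset ->
  pi_rep A B x h = \sum_(w <- d) mcoeff w x *: word_op A B (repr w) h.
Proof.
move=> xd; rewrite /pi_rep (big_fset_incl _ xd) //= => w _.
by move=> /mcoeff_outdom ->; rewrite scale0r.
Qed.

Lemma pi_repD x y h : pi_rep A B (x + y) h = pi_rep A B x h + pi_rep A B y h.
Proof.
rewrite (pi_repEw _ (msuppD_le x y)) (pi_repEw _ (fsubsetUl _ (msupp y))).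
rewrite (pi_repEw _ (fsubsetUr (msupp x) _)) -big_split /=.
by apply: eq_bigr => w _; rewrite mcoeffD scalerDl.
Qed.

Lemma pi_repZ c x h : pi_rep A B (c *: x) h = c *: pi_rep A B x h.
Proof.
rewrite (pi_repEw _ (msuppZ_le c x)) /pi_rep scaler_sumr.
by apply: eq_bigr => w _; rewrite mcoeffZ scalerA.
Qed.

Lemma pi_rep0 h : pi_rep A B 0 h = 0.
Proof. by rewrite -[0 : malg _ _](scale0r 0) pi_repZ scale0r. Qed.

Lemma pi_repU c w h :
  pi_rep A B (mkmalgU w c) h = c *: word_op A B (repr w) h.
Proof. by rewrite (pi_repEw _ msuppU_le) big_seq_fset1 mcoeffUU. Qed.

Lemma pi_rep_linear x : linear (pi_rep A B x).
Proof.
move=> a h h'; rewrite /pi_rep scaler_sumr -big_split /=.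
apply: eq_bigr => w _.
by rewrite word_op_linear scalerDr !scalerA mulrC.
Qed.

Lemma pi_rep_sum (I : Type) (r : seq I) (F : I -> malg Ftheta R[i]) h :
  pi_rep A B (\sum_(i <- r) F i) h = \sum_(i <- r) pi_rep A B (F i) h.
Proof.
exact: (big_morph (fun x => pi_rep A B x h) (fun x y => pi_repD x y h)
  (pi_rep0 h)).
Qed.

Lemma pi_repM x y h : pi_rep A B (x * y) h = pi_rep A B x (pi_rep A B y h).
Proof.
rewrite malgME pi_rep_sum [RHS]/pi_rep; apply: eq_bigr => w _.
rewrite pi_rep_sum.
have W : linear (word_op A B (repr w)) := word_op_linear (repr w).
have W0 : word_op A B (repr w) 0 = 0.
  by elim: (repr w) => //= l u ->; rewrite linear0.
have WD : {morph word_op A B (repr w) : a b / a + b}.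
  by move=> a b; rewrite -[a]scale1r W !scale1r.
have WZ c a : word_op A B (repr w) (c *: a) = c *: word_op A B (repr w) a.
  by rewrite -[c *: a]addr0 W W0 addr0.
rewrite [in RHS]/pi_rep (big_morph _ WD W0) scaler_sumr.
apply: eq_bigr => w' _; rewrite pi_repU WZ scalerA.
by congr (_ *: _); rewrite -word_op_cat; apply/word_op_cong/repr_cls.
Qed.

Definition l1_norm x : R := \sum_(w <- msupp x) Normc.normc (mcoeff w x).

Lemma l1_norm_ge0 x : 0 <= l1_norm x.
Proof. by apply: sumr_ge0 => w _; exact: normc_ge0. Qed.

Lemma pi_rep_le x h : hnorm (pi_rep A B x h) <= l1_norm x * hnorm h.
Proof.
rewrite /pi_rep /l1_norm mulr_suml.
elim/big_ind2: _ => [|a r b s ar bs|w _]; first by rewrite hnorm0.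
  by apply: le_trans (hnormD _ _) _; exact: lerD.
by rewrite hnormZ ler_wpM2l ?normc_ge0 // word_op_le.
Qed.

Lemma pi_rep_bounded x : bounded_op (@hnorm R H) (pi_rep A B x).
Proof.
by split; [exact: pi_rep_linear|exists (l1_norm x) => h; exact: pi_rep_le].
Qed.

End RepresentationTheory.

Section UnivNormTheory.
Variable R : realType.
Implicit Types (x y : malg Ftheta R[i]) (c : R[i]).

Lemma univ_norm_ge (H : hilbertSpace R) (A B : 'I_2 -> {linear H -> H}) x :
  row_contractive_rep A B -> opnorm (@hnorm R H) (pi_rep A B x) <= univ_norm x.
Proof.
move=> AB; apply: ub_le_sup; last by exists H, A, B.
exists (l1_norm x) => _ [H' [A' [B' [AB' ->]]]].
by apply: opnorm_le; [exact: l1_norm_ge0|exact: pi_rep_le].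
Qed.

Lemma univ_norm_le x M : 0 <= M ->
  (forall (H : hilbertSpace R) (A B : 'I_2 -> {linear H -> H}),
    row_contractive_rep A B -> opnorm (@hnorm R H) (pi_rep A B x) <= M) ->
  univ_norm x <= M.
Proof.
move=> M0 xM; rewrite /univ_norm; set S := [set r | _].
have [->|/set0P S0] := eqVneq S set0; first by rewrite sup0.
by apply: ge_sup => // _ [H [A [B [AB ->]]]]; exact: xM.
Qed.

Lemma univ_norm_ge0 x : 0 <= univ_norm x.
Proof.
rewrite /univ_norm; set S := [set r | _].
have [->|/set0P S0] := eqVneq S set0; first by rewrite sup0.
have [_ [H [A [B [AB _]]]]] := S0.
by apply: le_trans (univ_norm_ge x AB); apply/opnorm_ge0/pi_rep_bounded.
Qed.

Lemma pi_rep_univ_le (H : hilbertSpace R) (A B : 'I_2 -> {linear H -> H}) x h :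
  row_contractive_rep A B -> hnorm (pi_rep A B x h) <= univ_norm x * hnorm h.
Proof.
move=> AB; apply: le_trans (opnormP h (pi_rep_bounded AB x)) _.
by rewrite ler_wpM2r ?hnorm_ge0 // univ_norm_ge.
Qed.

Lemma univ_normD x y : univ_norm (x + y) <= univ_norm x + univ_norm y.
Proof.
apply: univ_norm_le => [|H A B AB]; first by rewrite addr_ge0 ?univ_norm_ge0.
apply: opnorm_le => [|h]; first by rewrite addr_ge0 ?univ_norm_ge0.
rewrite pi_repD mulrDl; apply: le_trans (hnormD _ _) _.
by rewrite lerD ?pi_rep_univ_le.
Qed.

Lemma univ_normZ c x : univ_norm (c *: x) <= Normc.normc c * univ_norm x.
Proof.
have cx0 : 0 <= Normc.normc c * univ_norm x.
  by rewrite mulr_ge0 ?normc_ge0 ?univ_norm_ge0.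
apply: univ_norm_le => // H A B AB; apply: opnorm_le => // h.
by rewrite pi_repZ hnormZ -mulrA ler_wpM2l ?normc_ge0 ?pi_rep_univ_le.
Qed.

Lemma univ_normM x y : univ_norm (x * y) <= univ_norm x * univ_norm y.
Proof.
have xy0 : 0 <= univ_norm x * univ_norm y by rewrite mulr_ge0 ?univ_norm_ge0.
apply: univ_norm_le => // H A B AB; apply: opnorm_le => // h.
rewrite pi_repM // -mulrA; apply: le_trans (pi_rep_univ_le _ _ AB) _.
by rewrite ler_wpM2l ?univ_norm_ge0 ?pi_rep_univ_le.
Qed.

End UnivNormTheory.

(** * Completion of an algebra in a submultiplicative seminorm *)

Record algSeminorm (R : realType) (P : lalgType R[i]) := AlgSeminorm {
  asnorm :> P -> R;
  asnorm_ge0 : forall x, 0 <= asnorm x;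
  asnormD : forall x y, asnorm (x + y) <= asnorm x + asnorm y;
  asnormZ : forall c x, asnorm (c *: x) <= Normc.normc c * asnorm x;
  asnormM : forall x y, asnorm (x * y) <= asnorm x * asnorm y }.

Section CauchySequences.
Variables (R : realType) (P : lalgType R[i]) (nu : algSeminorm P).
Implicit Types (u v : nat -> P) (x y : P).

Definition cauchy_pred : pred (nat -> P) := fun u => `[< cauchy_seq nu u >].

Definition null_seq u : Prop := (fun n => nu (u n)) @ \oo --> (0 : R).

Lemma asnorm0 : nu 0 = 0.
Proof.
apply/eqP; rewrite eq_le asnorm_ge0 andbT -[X in nu X](scale0r 0).
by apply: le_trans (asnormZ _ _ _) _; rewrite Normc.normc0 mul0r.
Qed.

Lemma asnormN x : nu (- x) = nu x.
Proof.
suff le y : nu (- y) <= nu y by apply/eqP; rewrite eq_le le -{1}[x]opprK le.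
rewrite -scaleN1r; apply: le_trans (asnormZ _ _ _) _.
by rewrite /= oppr0 expr0n addr0 sqrrN expr1n sqrtr1 mul1r.
Qed.

Lemma asnormB x y : nu (x - y) <= nu x + nu y.
Proof. by apply: le_trans (asnormD _ _ _) _; rewrite asnormN. Qed.

Lemma asnorm_dist x y : `|nu x - nu y| <= nu (x - y).
Proof.
have le a b : nu a - nu b <= nu (a - b).
  by rewrite lerBlDr -{1}[a](subrK b) asnormD.
by rewrite ler_norml lerNl opprB -[x - y]opprB asnormN !le -opprB asnormN le.
Qed.

Lemma null_seqP u : null_seq u <->
  forall e : R, 0 < e -> exists N, forall n, (N <= n)%N -> nu (u n) < e.
Proof.
split=> [/cvgr0Pnorm_lt h e e0|h].
  have [N _ Nh] := h _ e0; exists N => n Nn.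
  by have := Nh n Nn; rewrite /= ger0_norm ?asnorm_ge0.
apply/cvgr0Pnorm_lt => e e0; have [N Nh] := h _ e0; exists N => // n Nn.
by rewrite /= ger0_norm ?asnorm_ge0 ?Nh.
Qed.

Lemma cauchy_bounded u : cauchy_seq nu u ->
  exists2 M : R, 0 < M & exists N, forall n, (N <= n)%N -> nu (u n) <= M.
Proof.
move=> /(_ 1 ltr01)[N Nh]; exists (nu (u N) + 1).
  by rewrite ltr_wpDl ?asnorm_ge0.
exists N => n Nn; rewrite -lerBlDl; apply: le_trans (ler_norm _) _.
by apply: le_trans (asnorm_dist _ _) _; apply/ltW/Nh.
Qed.

Lemma cauchy_const x : cauchy_seq nu (fun=> x).
Proof. by move=> e e0; exists 0%N => i j _ _; rewrite subrr asnorm0. Qed.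

Lemma cauchyB u v : cauchy_seq nu u -> cauchy_seq nu v -> cauchy_seq nu (u - v).
Proof.
move=> cu cv e e0; have e2 : 0 < e / 2 by rewrite divr_gt0.
have [N1 h1] := cu _ e2; have [N2 h2] := cv _ e2; exists (maxn N1 N2) => i j.
rewrite !geq_max => /andP[i1 i2] /andP[j1 j2].
have -> : (u - v) i - (u - v) j = (u i - u j) - (v i - v j).
  by rewrite [LHS]/= !opprD !opprK addrACA.
by apply: le_lt_trans (asnormB _ _) _; rewrite [e]splitr ltrD ?h1 ?h2.
Qed.

Lemma cauchyZ c u : cauchy_seq nu u -> cauchy_seq nu (c *: u).
Proof.
move=> cu e e0; have c0 := normc_ge0 c.
have [N h] := cu (e / (Normc.normc c + 1)) (divr_gt0 e0 (ltr_wpDl c0 ltr01)).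
exists N => i j iN jN; have := h i j iN jN.
rewrite ltr_pdivlMr ?ltr_wpDl // => /(le_lt_trans _); apply.
have -> : (c *: u) i - (c *: u) j = c *: (u i - u j) by rewrite scalerBr.
apply: le_trans (asnormZ _ _ _) _.
by rewrite mulrC ler_wpM2l ?asnorm_ge0 // lerDl.
Qed.

Lemma cauchyM u v : cauchy_seq nu u -> cauchy_seq nu v -> cauchy_seq nu (u * v).
Proof.
move=> cu cv e e0.
have [M M0 [N1 h1]] := cauchy_bounded cu.
have [K K0 [N2 h2]] := cauchy_bounded cv.
have MK : 0 < M + K by rewrite addr_gt0.
have [N3 h3] := cu _ (divr_gt0 e0 MK); have [N4 h4] := cv _ (divr_gt0 e0 MK).
exists (maxn (maxn N1 N2) (maxn N3 N4)) => i j.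
rewrite !geq_max => /andP[/andP[i1 i2] /andP[i3 i4]].
move=> /andP[/andP[j1 j2] /andP[j3 j4]].
have -> : (u * v) i - (u * v) j = u i * (v i - v j) + (u i - u j) * v j.
  by rewrite mulrBr mulrBl addrA subrK.
apply: le_lt_trans (asnormD _ _ _) _.
apply: (@le_lt_trans _ _ (M * nu (v i - v j) + nu (u i - u j) * K)).
  rewrite lerD // (le_trans (asnormM _ _ _)) //.
    by rewrite ler_wpM2r ?asnorm_ge0 ?h1.
  by rewrite ler_wpM2l ?asnorm_ge0 ?h2.
have {h3}h3 := h3 i j i3 j3; have {h4}h4 := h4 i j i4 j4.
apply: (@lt_le_trans _ _ (M * (e / (M + K)) + e / (M + K) * K)).
  by rewrite ltrD ?ltr_pM2l ?ltr_pM2r.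
by rewrite mulrC -mulrDr divfK // gt_eqF.
Qed.

Lemma null_seqB u v : null_seq u -> null_seq v -> null_seq (u - v).
Proof.
move=> /null_seqP nu0 /null_seqP nv0; apply/null_seqP => e e0.
have e2 : 0 < e / 2 by rewrite divr_gt0.
have [N1 h1] := nu0 _ e2; have [N2 h2] := nv0 _ e2; exists (maxn N1 N2) => n.
rewrite geq_max => /andP[n1 n2].
by apply: le_lt_trans (asnormB _ _) _; rewrite [e]splitr ltrD ?h1 ?h2.
Qed.

Lemma null_seqZ c u : null_seq u -> null_seq (c *: u).
Proof.
move=> /null_seqP nu0; apply/null_seqP => e e0; have c0 := normc_ge0 c.
have [N h] := nu0 (e / (Normc.normc c + 1)) (divr_gt0 e0 (ltr_wpDl c0 ltr01)).
exists N => n Nn; have := h n Nn.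
rewrite ltr_pdivlMr ?ltr_wpDl // => /(le_lt_trans _); apply.
apply: le_trans (asnormZ _ _ _) _.
by rewrite mulrC ler_wpM2l ?asnorm_ge0 // lerDl.
Qed.

Lemma null_seqMl u v : cauchy_seq nu u -> null_seq v -> null_seq (u * v).
Proof.
move=> /cauchy_bounded[M M0 [N1 h1]] /null_seqP nv0; apply/null_seqP => e e0.
have [N2 h2] := nv0 _ (divr_gt0 e0 M0); exists (maxn N1 N2) => n.
rewrite geq_max => /andP[n1 n2]; apply: le_lt_trans (asnormM _ _ _) _.
apply: (@le_lt_trans _ _ (M * nu (v n))).
  by rewrite ler_wpM2r ?asnorm_ge0 ?h1.
by have := h2 n n2; rewrite ltr_pdivlMr // mulrC.
Qed.

Lemma null_seqMr u v : null_seq u -> cauchy_seq nu v -> null_seq (u * v).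
Proof.
move=> /null_seqP nu0 /cauchy_bounded[M M0 [N1 h1]]; apply/null_seqP => e e0.
have [N2 h2] := nu0 _ (divr_gt0 e0 M0); exists (maxn N1 N2) => n.
rewrite geq_max => /andP[n1 n2]; apply: le_lt_trans (asnormM _ _ _) _.
apply: (@le_lt_trans _ _ (nu (u n) * M)).
  by rewrite ler_wpM2l ?asnorm_ge0 ?h1.
by have := h2 n n2; rewrite ltr_pdivlMr.
Qed.

Lemma cauchy_norm_cvg u : cauchy_seq nu u -> cvgn (fun n => nu (u n)).
Proof.
move=> cu; apply/cauchy_cvgP/cauchy_exP => e e0.
have [N h] := cu e e0; exists (nu (u N)); exists N => // n Nn /=.
by apply: le_lt_trans (asnorm_dist _ _) _; exact: h.
Qed.

Lemma cauchy_pred_subring : subring_closed cauchy_pred.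
Proof.
split=> [|u v /asboolP cu /asboolP cv|u v /asboolP cu /asboolP cv]; apply/asboolP.
- exact: cauchy_const.
- exact: cauchyB.
- exact: cauchyM.
Qed.

Lemma cauchy_pred_scale : GRing.scaler_closed cauchy_pred.
Proof. by move=> c u /asboolP cu; apply/asboolP/cauchyZ. Qed.

HB.instance Definition _ :=
  GRing.isSubringClosed.Build (nat -> P) cauchy_pred cauchy_pred_subring.
HB.instance Definition _ :=
  GRing.isScaleClosed.Build R[i] (nat -> P) cauchy_pred cauchy_pred_scale.

Record cauchySeq := CauchySeq {
  cauchy_val : nat -> P;
  cauchy_valP : cauchy_pred cauchy_val }.

HB.instance Definition _ := [isSub for cauchy_val].
HB.instance Definition _ := [Choice of cauchySeq by <:].
HB.instance Definition _ :=
  GRing.SubChoice_isSubPzRing.Build (nat -> P) cauchy_pred cauchySeq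
    cauchy_pred_subring.
HB.instance Definition _ := [SubZmodule_isSubLmodule of cauchySeq by <:].

Definition null_pred : pred cauchySeq :=
  fun s => `[< null_seq (cauchy_val s) >].

Lemma null_pred_zmod : zmod_closed null_pred.
Proof.
split=> [|u v /asboolP cu /asboolP cv]; apply/asboolP; last exact: null_seqB.
by apply/null_seqP => e e0; exists 0%N => n _ /=; rewrite asnorm0.
Qed.

HB.instance Definition _ :=
  GRing.isZmodClosed.Build cauchySeq null_pred null_pred_zmod.

Lemma null_predMl (u v : cauchySeq) : v \in null_pred -> u * v \in null_pred.
Proof.
move=> /asboolP v0; apply/asboolP/null_seqMl => //.
exact/asboolP/(cauchy_valP u).
Qed.

Lemma null_predMr (u v : cauchySeq) : u \in null_pred -> u * v \in null_pred.
Proof.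
move=> /asboolP u0; apply/asboolP/null_seqMr => //.
exact/asboolP/(cauchy_valP v).
Qed.

Lemma null_predZ c (u : cauchySeq) : u \in null_pred -> c *: u \in null_pred.
Proof. by move=> /asboolP u0; apply/asboolP/null_seqZ. Qed.

Definition null_ideal := GRing.ZmodClosed.clone cauchySeq null_pred _.

Definition completion : Type := {ideal_quot null_ideal}.
HB.instance Definition _ := GRing.Zmodule.copy completion {ideal_quot null_ideal}.

Local Notation cpi := (\pi_({ideal_quot null_ideal})%qT).

Definition completion_one : completion := cpi 1.
Definition completion_mul (s t : completion) : completion :=
  cpi (repr s * repr t).
Definition completion_scale (c : R[i]) (t : completion) : completion :=
  cpi (c *: repr t).

Lemma cpiP (u v : cauchySeq) : cpi u = cpi v <-> u - v \in null_pred.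
Proof. by rewrite Quotient.idealrBE; split=> /eqP. Qed.

Lemma cpi_repr (u : cauchySeq) : repr (cpi u) - u \in null_pred.
Proof. by apply/cpiP; rewrite reprK. Qed.

Lemma cpi_ind (Q : completion -> Prop) :
  (forall u : cauchySeq, Q (cpi u)) -> forall t, Q t.
Proof. by move=> Qpi t; rewrite -[t]reprK. Qed.

Lemma cpiD (u v : cauchySeq) : cpi (u + v) = cpi u + cpi v :> completion.
Proof. exact: Quotient.pi_add. Qed.

Lemma cpiM (u v : cauchySeq) : completion_mul (cpi u) (cpi v) = cpi (u * v).
Proof.
apply/cpiP; set u' := repr _; set v' := repr _.
have -> : u' * v' - u * v = u' * (v' - v) + (u' - u) * v.
  by rewrite mulrBr mulrBl addrA subrK.
by apply: rpredD; [apply/null_predMl/cpi_repr|apply/null_predMr/cpi_repr].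
Qed.

Lemma cpiZ c (u : cauchySeq) : completion_scale c (cpi u) = cpi (c *: u).
Proof. by apply/cpiP; rewrite -scalerBr; apply/null_predZ/cpi_repr. Qed.

Lemma completion_mulA : associative completion_mul.
Proof.
by do 3!elim/cpi_ind=> ?; rewrite !cpiM mulrA.
Qed.

Lemma completion_mul1 : left_id completion_one completion_mul.
Proof. by elim/cpi_ind=> ?; rewrite cpiM mul1r. Qed.

Lemma completion_1mul : right_id completion_one completion_mul.
Proof. by elim/cpi_ind=> ?; rewrite cpiM mulr1. Qed.

Lemma completion_mulDl : left_distributive completion_mul +%R.
Proof. by do 3!elim/cpi_ind=> ?; rewrite !cpiM -!cpiD cpiM mulrDl. Qed.

Lemma completion_mulDr : right_distributive completion_mul +%R.
Proof. by do 3!elim/cpi_ind=> ?; rewrite !cpiM -!cpiD cpiM mulrDr. Qed.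

HB.instance Definition _ := GRing.Zmodule_isPzRing.Build completion
  completion_mulA completion_mul1 completion_1mul
  completion_mulDl completion_mulDr.

Lemma completion_scaleA a b t :
  completion_scale a (completion_scale b t) = completion_scale (a * b) t.
Proof. by elim/cpi_ind: t => ?; rewrite !cpiZ scalerA. Qed.

Lemma completion_scale1 : left_id 1 completion_scale.
Proof. by elim/cpi_ind=> ?; rewrite cpiZ scale1r. Qed.

Lemma completion_scaleDr : right_distributive completion_scale +%R.
Proof.
by move=> a; do 2!elim/cpi_ind=> ?; rewrite !cpiZ -!cpiD cpiZ scalerDr.
Qed.

Lemma completion_scaleDl t :
  {morph completion_scale^~ t : a b / a + b}.
Proof. by elim/cpi_ind: t => ? a b; rewrite !cpiZ -!cpiD scalerDl. Qed.

HB.instance Definition _ := GRing.Zmodule_isLmodule.Build R[i] completion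
  completion_scaleA completion_scale1 completion_scaleDr completion_scaleDl.

Definition completion_norm (t : completion) : R :=
  lim ((fun n => nu (cauchy_val (repr t) n)) @ \oo).

Lemma completion_norm_pi (u : cauchySeq) :
  completion_norm (cpi u) = lim ((fun n => nu (cauchy_val u n)) @ \oo).
Proof.
have cu := asboolW (cauchy_valP u).
have cr := asboolW (cauchy_valP (repr (cpi u))).
apply/eqP; rewrite -subr_eq0 -limB; [|exact: cauchy_norm_cvg..].
apply/eqP/cvg_lim => //; apply: norm_cvg0.
have /asboolP ru0 : null_pred (repr (cpi u) - u) := cpi_repr u.
apply: (squeeze_cvgr _ (cvg_cst 0) ru0); apply: nearW => n.
by rewrite normr_ge0 /=; exact: asnorm_dist.
Qed.

Definition to_completion (x : P) : completion :=
  cpi (CauchySeq (asboolT (cauchy_const x))).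

Lemma completion_norm_to x : completion_norm (to_completion x) = nu x.
Proof. by rewrite completion_norm_pi /= lim_cst. Qed.

End CauchySequences.

Definition univ_seminorm (R : realType) : algSeminorm (malg Ftheta R[i]) :=
  AlgSeminorm (@univ_norm_ge0 R) (@univ_normD R) (@univ_normZ R)
    (@univ_normM R).

(* The tensor algebra T_+(X_u), for the flip u. *)
Definition tensor_algebra (R : realType) := completion (univ_seminorm R).
HB.instance Definition _ (R : realType) := GRing.PzRing.on (tensor_algebra R).
HB.instance Definition _ (R : realType) := GRing.Lmodule.on (tensor_algebra R).

Definition tensor_norm (R : realType) (t : tensor_algebra R) : R :=
  completion_norm t.

(** * The left regular representation on l^2 *)

Section Ell2.
Variable R : realType.
Implicit Types f g : Ftheta -> R[i]^o.

Definition sqsum f : \bar R :=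
  (\esum_(x in [set: Ftheta]) (Normc.normc (f x) ^+ 2)%:E)%E.

Definition sqsummable : pred (Ftheta -> R[i]^o) := fun f => (sqsum f < +oo)%E.

Lemma normc_le_D (a b : R[i]) :
  Normc.normc (a + b) <= Normc.normc a + Normc.normc b.
Proof.
by have := ler_normD a b; rewrite lecE => /andP[_].
Qed.

Lemma sqsummable_submod : submod_closed sqsummable.
Proof.
suff [D Z] : (forall f g, sqsummable f -> sqsummable g -> sqsummable (f + g)) /\
    (forall c f, sqsummable f -> sqsummable (c *: f)).
  split=> [|c f g fs gs]; last exact/D/gs/Z.
  rewrite /sqsummable unfold_in /sqsum esum1 ?ltry // => x _.
  by rewrite Normc.normc0 expr0n.
have sq0 h x : (0 <= (Normc.normc (h x : R[i]) ^+ 2)%:E)%E.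
  by rewrite lee_fin sqr_ge0.
split=> [f g|c f]; rewrite /sqsummable /sqsum => fs.
  move=> gs; apply: (@le_lt_trans _ _ (\esum_(x in [set: Ftheta])
      (((Normc.normc (f x) ^+ 2)%:E + (Normc.normc (f x) ^+ 2)%:E) +
       ((Normc.normc (g x) ^+ 2)%:E + (Normc.normc (g x) ^+ 2)%:E))%E)).
    apply: le_esum => x _; rewrite -!EFinD lee_fin.
    apply: le_trans (_ : (Normc.normc (f x) + Normc.normc (g x)) ^+ 2 <= _).
      by rewrite ler_pXn2r ?nnegrE ?addr_ge0 ?normc_ge0 // normc_le_D.
    have := sqr_ge0 (Normc.normc (f x) - Normc.normc (g x)); nra.
  rewrite !esumD // => [|x _|x _]; rewrite ?adde_ge0 //.
  by rewrite !lte_add_pinfty.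
pose n := (Num.truncn (Normc.normc c ^+ 2)).+1.
apply: (@le_lt_trans _ _ (\esum_(x in [set: Ftheta])
    \sum_(i <- iota 0 n | xpredT i) (Normc.normc (f x) ^+ 2)%:E)%E).
  apply: le_esum => x _; rewrite sumEFin lee_fin Normc.normcM exprMn.
  rewrite big_const_seq iter_addr_0 count_predT size_iota -mulr_natl.
  by rewrite ler_wpM2r ?sqr_ge0 // ltW // truncnS_gt.
by rewrite esum_sum //; apply: lte_sum_pinfty.
Qed.

HB.instance Definition _ := GRing.isSubmodClosed.Build R[i] (Ftheta -> R[i]^o)
  sqsummable sqsummable_submod.

Record ell2 := Ell2 {
  ell2_val :> Ftheta -> R[i]^o;
  ell2_valP : sqsummable ell2_val }.

HB.instance Definition _ := [isSub for ell2_val].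
HB.instance Definition _ := [Choice of ell2 by <:].
HB.instance Definition _ := [SubChoice_isSubLmodule of ell2 by <:].

Definition ell2_norm (f : ell2) : R := Num.sqrt (fine (sqsum f)).

Definition delta (x : Ftheta) : Ftheta -> R[i]^o := fun y => (y == x)%:R.

Lemma delta_sqsummable x : sqsummable (delta x).
Proof.
rewrite /sqsummable /sqsum (esumID [set x]); last first.
  by move=> y _; rewrite lee_fin sqr_ge0.
rewrite !setTI esum_set1 ?lee_fin ?sqr_ge0 // esum1 ?adde0 ?ltry // => y /= yx.
by rewrite /delta; case: eqP => // _; rewrite Normc.normc0 expr0n.
Qed.

(* The orthonormal basis of point masses. *)
Definition xi (x : Ftheta) : ell2 := Ell2 (delta_sqsummable x).

(* The extension of [xi x |-> xi (w x)]: the value at y is transported to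
   w y, and the values off the range of [mulF w] are 0. *)
Definition left_shift (w : Ftheta) f : Ftheta -> R[i]^o := fun x =>
  if pselect (exists y, x = mulF w y) is left h then f (projT1 (cid h)) else 0.

Lemma left_shift_mul w f y : left_shift w f (mulF w y) = f y.
Proof.
rewrite /left_shift; case: pselect => [h|[]]; last by exists y.
by congr f; apply: (@mulFI w); rewrite -(projT2 (cid h)).
Qed.

Lemma sqsum_left_shift w f : sqsum (left_shift w f) = sqsum f.
Proof.
have injw : set_inj [set: Ftheta] (mulF w) by move=> ? ? _ _; exact: mulFI.
transitivity (\esum_(x in mulF w @` [set: Ftheta])
    (Normc.normc (left_shift w f x) ^+ 2)%:E)%E.
  rewrite [RHS]esum_mkcond; apply: eq_esum => x _; case: ifPn => // /negP xw.
  rewrite /left_shift; case: pselect => [[y xy]|_].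
    by case: xw; apply/mem_set; exists y.
  by rewrite Normc.normc0 expr0n.
by rewrite esum_image //; apply: eq_esum => y _; rewrite left_shift_mul.
Qed.

Lemma left_shift_sqsummable w (f : ell2) : sqsummable (left_shift w f).
Proof. by rewrite /sqsummable sqsum_left_shift; exact: ell2_valP. Qed.

Definition lambda (w : Ftheta) (f : ell2) : ell2 :=
  Ell2 (left_shift_sqsummable w f).

Lemma lambda_xi w x : lambda w (xi x) = xi (mulF w x).
Proof.
apply/val_inj/funext => z /=.
have [[y ->]|nh] := pselect (exists y, z = mulF w y).
  by rewrite left_shift_mul /delta (inj_eq (@mulFI w)).
rewrite /left_shift /delta; case: pselect => // _.
by case: eqP => // zw; case: nh; exists x.
Qed.

Lemma lambda_isometry w (f : ell2) : ell2_norm (lambda w f) = ell2_norm f.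
Proof. by rewrite /ell2_norm /= sqsum_left_shift. Qed.

Lemma lambda_linear w : linear (lambda w).
Proof.
move=> c f g; apply/val_inj/funext => z /=.
by rewrite /left_shift !fctE /=; case: pselect => // _; rewrite scaler0 addr0.
Qed.

End Ell2.

(** * The algebra A_u *)

Record closed_unital_algebra (R : realType) (V : lmodType R[i]) (nu : V -> R)
    (D : set (V -> V)) : Prop := ClosedUnitalAlgebra {
  cua_bounded : D `<=` bounded_op nu;
  cua_id : D idfun;
  cua_add : forall S T, D S -> D T -> D (S \+ T);
  cua_scale : forall (c : R[i]) S, D S -> D (c \*: S);
  cua_comp : forall S T, D S -> D T -> D (S \o T);
  cua_closed : forall T, bounded_op nu T ->
    (forall e : R, 0 < e -> exists2 S, D S & opnorm nu (S \- T) < e) -> D T }.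

Definition Au (R : realType) : set (ell2 R -> ell2 R) :=
  smallest (closed_unital_algebra (@ell2_norm R)) (range (@lambda R)).

(* Only the values of [Phi] on [Au R] matter. Its injectivity there follows
   from linearity and isometry, and surjectivity forces it to be unital. *)
Definition isometric_isomorphism (R : realType)
    (Phi : (ell2 R -> ell2 R) -> tensor_algebra R) : Prop :=
  [/\ forall S T, Au S -> Au T -> Phi (S \+ T) = Phi S + Phi T,
      forall (c : R[i]) S, Au S -> Phi (c \*: S) = c *: Phi S,
      forall S T, Au S -> Au T -> Phi (S \o T) = Phi S * Phi T,
      forall S, Au S -> tensor_norm (Phi S) = opnorm (@ell2_norm R) S
    & forall t, exists2 S, Au S & Phi S = t].

(* Main.v *)
From HB Require Import structures.
Require Import Defs.
From mathcomp Require Import all_boot all_order all_algebra finmap.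
From mathcomp Require Import all_classical all_reals.
From mathcomp Require Import ereal topology normedtype sequences esum realfun.
From mathcomp Require Import complex ring lra.
From mathcomp Require monalg.
Import -(notations) monalg.

Set Implicit Arguments.
Unset Strict Implicit.
Unset Printing Implicit Defensive.

Import Order.TTheory GRing.Theory Num.Theory.
Import numFieldNormedType.Exports.

Local Open Scope classical_set_scope.
Local Open Scope ring_scope.

(** Both algebras remember, in an isometrically invariant way, a norm on the
    four-dimensional space of elements of degree one, and these two norms are
    not linearly isometric.

    On the tensor algebra side, two row contractions [A] and [B] with all
    products of two entries equal to zero form a row contractive
    representation, so they can be chosen independently: the norm of [sum a_i e_i + sum b_j f_j],
    already modulo elements of degree at least two, is [|a| + |b|]
    ([tlin_vnorm_le], [tensor_norm_tlin_elt]).  On the side of [A_u], a word is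
    a pair made of a sequence [s] of indices and of the number [k] of letters
    [e], and [e_i] raises [k] by one while [f_i] keeps it.  So [e_i] is the
    creation operator of index [i] times a shift that commutes with it, and
    the same norm is the maximum of [|a z + b|] over the unit circle, with
    square [|a|^2 + |b|^2 + 2 |<a, b>|] ([lin_op_norm_le], [coef1_le],
    [cross_phase]).

    An isometric isomorphism [Phi] need not be graded a priori, but it
    preserves the augmentation, because the corresponding point is the singular
    point of the variety [a_1 b_2 = a_2 b_1] of characters.  Concretely, the
    augmentation of the tensor algebra and its four point derivations in degree
    one pull back along [Phi] to a character [psi] of [A_u] and to four
    linearly independent derivations at [psi] ([der_gen_free]).  The relation
    [e_1 f_2 = f_1 e_2] confines the values of derivations on the generators to
    a hyperplane unless [psi] vanishes on the generators ([psi_gen]).  Then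
    [psi] is the augmentation of [A_u], the pulled back derivations are
    combinations of the degree-one coefficients ([psi_der_coef]), and [Phi]
    induces a linear isometry between the two degree-one norms.

    Such an isometry cannot exist ([det_ef_L]).  The tensor norm is additive
    on [p + t q], where [p] and [q] come from the [e] part and the [f] part
    and [t] is unimodular.  In the norm of [A_u] this is an equality case of
    the triangle inequality at some point [z] of the circle, so the values at
    [z] of suitable multiples of [p] and [t q] agree.  Their difference, seen
    as a 2 by 2 matrix with columns [a] and [b], kills a nonzero vector and has
    determinant zero.  Varying [t] makes the determinant vanish on the whole
    space of 2 by 2 matrices. *)

(** * Complex numbers: squared modulus and limits *)

Section SquaredModulus.
Variable R : realType.
Implicit Types a b c : R[i].

Definition absq c : R := complex.Re c ^+ 2 + complex.Im c ^+ 2.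

Lemma normc_sqr c : Normc.normc c ^+ 2 = absq c.
Proof. by case: c => a b; rewrite /= sqr_sqrtr // addr_ge0 ?sqr_ge0. Qed.

Lemma absq_ge0 c : 0 <= absq c.
Proof. by rewrite addr_ge0 ?sqr_ge0. Qed.

Lemma absq0 : absq 0 = 0.
Proof. by rewrite /absq /= expr0n addr0. Qed.

Lemma absqM a b : absq (a * b) = absq a * absq b.
Proof. by case: a b => a1 a2 [b1 b2]; rewrite /absq /=; ring. Qed.

Lemma absq_real (x : R) : absq (Complex x 0) = x ^+ 2.
Proof. by rewrite /absq /= expr0n addr0. Qed.

Lemma absq1 : absq 1 = 1.
Proof. by rewrite absq_real expr1n. Qed.

Lemma absqN c : absq (- c) = absq c.
Proof. by case: c => a b; rewrite /absq /= !sqrrN. Qed.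

Lemma absqJ c : absq (conjc c) = absq c.
Proof. by case: c => a b; rewrite /absq /= sqrrN. Qed.

Lemma absqX c n : absq (c ^+ n) = absq c ^+ n.
Proof. by elim: n => [|n IHn]; rewrite ?expr0 ?absq1 // !exprS absqM IHn. Qed.

Lemma absqD a b :
  absq (a + b) = absq a + absq b + 2 * complex.Re (a * conjc b).
Proof. by case: a b => a1 a2 [b1 b2]; rewrite /absq /=; ring. Qed.

Lemma absq_eq0 c : absq c = 0 -> c = 0.
Proof. by rewrite -normc_sqr => /eqP; rewrite sqrf_eq0 => /eqP/Normc.eq0_normc. Qed.

Lemma mul_conj c : c * conjc c = Complex (absq c) 0.
Proof. by case: c => a b; rewrite /absq; simpc; congr Complex; ring. Qed.

End SquaredModulus.

Section ComplexLimits.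
Variable R : realType.
Implicit Types (u v : nat -> R[i]) (l m c : R[i]).

(** Convergence of a complex sequence is stated for the real and imaginary
    parts, so that limits and completeness are those of the real line. *)
Definition ccvg u l : Prop :=
  (fun n => complex.Re (u n)) @ \oo --> complex.Re l /\
  (fun n => complex.Im (u n)) @ \oo --> complex.Im l.

Definition clim u : R[i] :=
  Complex (lim ((fun n => complex.Re (u n)) @ \oo))
          (lim ((fun n => complex.Im (u n)) @ \oo)).

Lemma re_le_normc c : `|complex.Re c| <= Normc.normc c.
Proof. by case: c => a b; rewrite -sqrtr_sqr /= ler_wsqrtr // lerDl sqr_ge0. Qed.

Lemma im_le_normc c : `|complex.Im c| <= Normc.normc c.
Proof. by case: c => a b; rewrite -sqrtr_sqr /= ler_wsqrtr // lerDr sqr_ge0. Qed.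

Lemma cauchy_dist_cvg (V : zmodType) (nu : V -> R) (u : nat -> V) (a : V -> R) :
  (forall x y, `|a x - a y| <= nu (x - y)) -> cauchy_seq nu u ->
  cvgn (fun n => a (u n)).
Proof.
move=> a_le cu; apply/cauchy_cvgP/cauchy_exP => e e0.
have [N h] := cu e e0; exists (a (u N)); exists N => // n Nn /=.
by apply: le_lt_trans (a_le _ _) _; exact: h.
Qed.

Lemma clim_cvg u : cauchy_seq (@Normc.normc R) u -> ccvg u (clim u).
Proof.
move=> cu; split; apply: (cauchy_dist_cvg _ cu) => x y.
  by rewrite -raddfB re_le_normc.
by rewrite -raddfB im_le_normc.
Qed.

Lemma ccvg_unique u l m : ccvg u l -> ccvg u m -> l = m.
Proof.
move=> [ul ul'] [um um']; apply/eqP; rewrite eq_complex.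
by rewrite (cvg_unique _ ul um) // (cvg_unique _ ul' um') // !eqxx.
Qed.

Lemma ccvg_cst c : ccvg (fun=> c) c.
Proof. by split; exact: cvg_cst. Qed.

Lemma ccvgD u v l m : ccvg u l -> ccvg v m -> ccvg (fun n => u n + v n) (l + m).
Proof.
by move=> [ul ul'] [um um'];
  split; rewrite raddfD; under eq_fun do rewrite raddfD; exact: cvgD.
Qed.

Lemma ReM c l :
  complex.Re (c * l) = complex.Re c * complex.Re l - complex.Im c * complex.Im l.
Proof. by case: c l => a b [a' b']. Qed.

Lemma ImM c l :
  complex.Im (c * l) = complex.Re c * complex.Im l + complex.Im c * complex.Re l.
Proof. by case: c l => a b [a' b']. Qed.

Lemma ccvgM u v l m : ccvg u l -> ccvg v m -> ccvg (fun n => u n * v n) (l * m).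
Proof.
move=> [ul ul'] [um um']; split.
  by rewrite ReM; under eq_fun do rewrite ReM; apply: cvgB; exact: cvgM.
by rewrite ImM; under eq_fun do rewrite ImM; apply: cvgD; exact: cvgM.
Qed.

Lemma ccvg_sum (I : finType) (u : I -> nat -> R[i]) (l : I -> R[i]) :
  (forall i, ccvg (u i) (l i)) -> ccvg (fun n => \sum_i u i n) (\sum_i l i).
Proof.
move=> ul; elim: (index_enum I) => [|i r IHr].
  by under eq_fun do rewrite big_nil; rewrite big_nil; exact: ccvg_cst.
by under eq_fun do rewrite big_cons; rewrite big_cons; exact: ccvgD.
Qed.

Lemma ccvg_absq u l : ccvg u l -> (fun n => absq (u n)) @ \oo --> absq l.
Proof.
by move=> [ul ul']; rewrite /absq; under eq_fun do rewrite !expr2;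
  rewrite !expr2; apply: cvgD; exact: cvgM.
Qed.

Lemma ccvg0 u : (fun n => Normc.normc (u n)) @ \oo --> (0 : R) -> ccvg u 0.
Proof.
move=> u0; split; apply: norm_cvg0; apply: (squeeze_cvgr _ (cvg_cst 0) u0);
  apply: nearW => n; rewrite normr_ge0 /=; [exact: re_le_normc|exact: im_le_normc].
Qed.

End ComplexLimits.

(** * The Hilbert space C^2 *)

Section PlaneHilbert.
Variable R : realType.
Local Notation C2 := (R[i]^o * R[i]^o)%type.

Definition dot2 (x y : C2) : R[i] := x.1 * conjc y.1 + x.2 * conjc y.2.

Lemma dot2_bilinear : bilinear_for
  (GRing.Scale.Law.clone _ _ ( *%R ) _)
  (GRing.Scale.Law.clone _ _ (Num.conj \; *%R ) _) dot2.
Proof.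
split=> [y|x] c u v; rewrite /dot2 /=.
  by rewrite /GRing.scale /= !mulrDl !mulrDr !mulrA addrACA.
have -> : forall d : R[i], d^*%R = conjc d by [].
rewrite /GRing.scale /= !rmorphD !rmorphM /= !mulrDr addrACA !mulrA.
by rewrite ![_ * conjc c]mulrC.
Qed.

HB.instance Definition _ := bilinear_isBilinear.Build R[i] C2 C2 R[i]
  (GRing.Scale.Law.clone _ _ ( *%R ) _)
  (GRing.Scale.Law.clone _ _ (Num.conj \; *%R ) _) dot2 dot2_bilinear.

Lemma dot2_herm (x y : C2) :
  dot2 x y = (-1) ^+ false * (dot2 y x)^*%R.
Proof.
rewrite expr0 mul1r -[RHS]/(conjc _) /dot2 rmorphD !rmorphM /= !conjcK.
by congr (_ + _); rewrite mulrC.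
Qed.

HB.instance Definition _ := @isHermitianSesquilinear.Build R[i] C2 false
  Num.conj dot2 dot2_herm.

Lemma dot2E (x : C2) : dot2 x x = Complex (absq x.1 + absq x.2) 0.
Proof. by rewrite /dot2 !mul_conj; simpc. Qed.

Lemma dot2_gt0 (x : C2) : x != 0 -> 0 < dot2 x x.
Proof.
move=> x0; rewrite dot2E ltcE /= eqxx /= lt_def addr_ge0 ?absq_ge0 // andbT.
apply: contra x0 => /eqP; case: x => a b /= /eqP.
rewrite paddr_eq0 ?absq_ge0 // => /andP[/eqP/absq_eq0 -> /eqP/absq_eq0 ->].
exact: eqxx.
Qed.

HB.instance Definition _ := @isDotProduct.Build R[i] C2 dot2 dot2_gt0.

Lemma dot2_normE (x : C2) :
  dot_norm dot2 x = Num.sqrt (absq x.1 + absq x.2).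
Proof.
by transitivity (Num.sqrt (complex.Re (dot2 x x))) => //; rewrite dot2E.
Qed.

Lemma dot2_complete (u : nat -> C2) : cauchy_seq (dot_norm dot2) u ->
  exists l, norm_cvg (dot_norm dot2) u l.
Proof.
move=> cu.
have c1 : ccvg (fun n => (u n).1) (clim (fun n => (u n).1)).
  apply: clim_cvg => e /cu[N h]; exists N => i j iN jN.
  apply: le_lt_trans (h i j iN jN); rewrite dot2_normE -normc_sqr.
  rewrite -[leLHS]ger0_norm ?normc_ge0 // -sqrtr_sqr ler_wsqrtr //.
  by rewrite lerDl absq_ge0.
have c2 : ccvg (fun n => (u n).2) (clim (fun n => (u n).2)).
  apply: clim_cvg => e /cu[N h]; exists N => i j iN jN.
  apply: le_lt_trans (h i j iN jN); rewrite dot2_normE -(normc_sqr (u i - u j).2).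
  rewrite -[leLHS]ger0_norm ?normc_ge0 // -sqrtr_sqr ler_wsqrtr //.
  by rewrite lerDr absq_ge0.
exists (clim (fun n => (u n).1), clim (fun n => (u n).2)).
have cB v l : ccvg v l -> (fun n => absq (v n - l)) @ \oo --> (0 : R).
  by move=> vl; rewrite -(absq0 R) -(subrr l); apply/ccvg_absq/(ccvgD vl (ccvg_cst _)).
rewrite /norm_cvg; under eq_fun do rewrite dot2_normE.
have s0 : 0 = Num.sqrt (0 + 0 : R) by rewrite addr0 sqrtr0.
rewrite s0; apply: (continuous_cvg _ (@sqrt_continuous _ _)).
by apply: cvgD; exact: cB.
Qed.

(** Two dimensions suffice to separate the degree-one coefficients: this is the
    space of the nilpotent representations below. *)
Definition plane : hilbertSpace R := HilbertSpace dot2_complete.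

Lemma plane_normE (x : plane) : hnorm x ^+ 2 = absq (x : C2).1 + absq (x : C2).2.
Proof.
by rewrite /hnorm dot2_normE sqr_sqrtr // addr_ge0 ?absq_ge0.
Qed.
End PlaneHilbert.

(** * Nilpotent representations and coefficients of degree at most one *)

Section NilpotentRepresentation.
Variable R : realType.
Local Notation C2 := (R[i]^o * R[i]^o)%type.

(** Lagrange identity: the defect is a squared modulus. *)
Lemma absq_cauchy_schwarz (a b x y : R[i]) :
  absq (a * x + b * y) <= (absq a + absq b) * (absq x + absq y).
Proof.
have -> : (absq a + absq b) * (absq x + absq y) =
    absq (a * x + b * y) + absq (a * conjc y - b * conjc x).
  by case: a b x y => a1 a2 [b1 b2] [x1 x2] [y1 y2]; rewrite /absq /=; ring.
by rewrite lerDl absq_ge0.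
Qed.

(** The nilpotent matrix with the single entry [a] in the upper right corner. *)
Definition shift2 (a : R[i]) (h : plane R) : plane R :=
  ((a * (h : C2).2, 0) : C2).

Lemma shift2_linear a : linear (shift2 a).
Proof.
move=> c h h'; congr pair; rewrite /= ?scaler0 ?addr0 //.
by rewrite /GRing.scale /= mulrDr !mulrA [a * c]mulrC.
Qed.

HB.instance Definition _ a := GRing.isLinear.Build R[i] (plane R) (plane R)
  *:%R (shift2 a) (shift2_linear a).

(** The rows with entries [c (e_ i)] and [c (f_ j)] are bounded by 1 separately;
    this independence is what makes the universal norm larger than the norm of
    the regular representation. *)
Definition unit_ball_coeffs (c : letter -> R[i]) : Prop :=
  \sum_i absq (c (e_ i)) <= 1 /\ \sum_j absq (c (f_ j)) <= 1.

Lemma shift2_row (c : 'I_2 -> R[i]) : \sum_i absq (c i) <= 1 ->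
  row_contraction (fun i => shift2 (c i) : {linear plane R -> plane R}).
Proof.
rewrite big_ord_recl big_ord1 => c1 x; rewrite !big_ord_recl !big_ord0 !addr0.
rewrite !plane_normE /= addr0 absq0 addr0.
apply: le_trans (absq_cauchy_schwarz _ _ _ _) _.
apply: (@le_trans _ _ (absq (x ord0).2 + absq (x (lift ord0 ord0)).2)).
  by rewrite -[leRHS]mul1r ler_wpM2r // addr_ge0 ?absq_ge0.
by apply: lerD; rewrite lerDr absq_ge0.
Qed.

Variable c : letter -> R[i].

Definition rep_e (i : 'I_2) : {linear plane R -> plane R} := shift2 (c (e_ i)).
Definition rep_f (i : 'I_2) : {linear plane R -> plane R} := shift2 (c (f_ i)).

(** The commutation relation holds because both products vanish. *)
Lemma shift2_rep : unit_ball_coeffs c -> row_contractive_rep rep_e rep_f.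
Proof.
move=> [ce cf]; split; [exact: shift2_row|exact: shift2_row|] => i j h.
by rewrite /= /shift2 /= !mulr0.
Qed.

Lemma word_shift2 (u : seq letter) (h : plane R) :
  word_op rep_e rep_f u h = match u with
    | [::] => h | [:: l] => shift2 (c l) h | _ => 0 end.
Proof.
elim: u => [//|l u IHu].
have -> : word_op rep_e rep_f (l :: u) h =
    shift2 (c l) (word_op rep_e rep_f u h) by case: l.
rewrite {}IHu; case: u => [|l' [|l'' u]] //; last by rewrite linear0.
by rewrite /shift2 /= mulr0.
Qed.

End NilpotentRepresentation.

Section DegreeOne.
Variable R : realType.
Local Notation C2 := (R[i]^o * R[i]^o)%type.
Local Notation P := (malg Ftheta R[i]).
Implicit Types (x y : P) (c : letter -> R[i]).

(** The constant coefficient; the size of the representing word depends on the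
    class only. *)
Definition augm x : R[i] :=
  \sum_(w <- msupp x) mcoeff w x * (repr w == [::])%:R.

(** The functional with weight [c l] on the generator [l]. *)
Definition lin_coeff c x : R[i] := \sum_(w <- msupp x)
  mcoeff w x * (if repr w is [:: l] then c l else 0).

(** The representation attached to [c] sends [x] to the upper triangular matrix
    with [augm x] on the diagonal and [lin_coeff c x] in the corner.  All
    algebraic properties of the two functionals are read off this matrix, among
    them that [lin_coeff c] is a derivation at the character [augm]. *)
Lemma pi_shift2 c x (h : plane R) : pi_rep (rep_e c) (rep_f c) x h =
  ((augm x * (h : C2).1 + lin_coeff c x * (h : C2).2, augm x * (h : C2).2) : C2).
Proof.
rewrite /pi_rep /augm /lin_coeff !mulr_suml -big_split /=.
have E (s : seq Ftheta) (F G : Ftheta -> R[i]) :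
    (\sum_(w <- s) F w, \sum_(w <- s) G w) = \sum_(w <- s) ((F w, G w) : C2).
  elim: s => [|w s IHs]; first by rewrite !big_nil.
  by rewrite !big_cons -IHs.
rewrite E; apply: eq_bigr => w _; rewrite word_shift2.
case: (repr w) => [|l [|l' u]] /=.
- by rewrite mulr0 mul0r addr0 mulr1; case: h.
- rewrite mulr0 !mul0r add0r; congr pair; rewrite /= /GRing.scale /= ?mulr0 //.
  by rewrite mulrA.
- by rewrite !mulr0 !mul0r addr0 scaler0.
Qed.

Lemma augm_lin_coeff_mul c x y : unit_ball_coeffs c ->
  augm (x * y) = augm x * augm y /\
  lin_coeff c (x * y) = augm x * lin_coeff c y + lin_coeff c x * augm y.
Proof.
move=> c1; have := pi_repM (shift2_rep c1) x y ((0, 1) : C2).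
rewrite !pi_shift2 /= !mulr0 !mulr1 !add0r => -[-> ->].
by [].
Qed.

Lemma augm_add x y : augm (x + y) = augm x + augm y.
Proof.
have c1 : unit_ball_coeffs (fun=> 0 : R[i]).
  by split; rewrite big1 // => i _; rewrite absq0.
have := pi_repD (rep_e (fun=> 0)) (rep_f (fun=> 0)) x y ((0, 1) : C2).
by rewrite !pi_shift2 /= !mulr0 !mulr1 !add0r => -[_ ->].
Qed.

Lemma lin_coeff_add c x y : lin_coeff c (x + y) = lin_coeff c x + lin_coeff c y.
Proof.
have := pi_repD (rep_e c) (rep_f c) x y ((0, 1) : C2).
by rewrite !pi_shift2 /= !mulr0 !mulr1 !add0r => -[-> _].
Qed.

Lemma augm_scale a x : augm (a *: x) = a * augm x.
Proof.
have := pi_repZ (rep_e (fun=> 0)) (rep_f (fun=> 0)) a x ((0, 1) : C2).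
by rewrite !pi_shift2 /= !mulr0 !mulr1 !add0r => -[_ ->].
Qed.

Lemma lin_coeff_scale c a x : lin_coeff c (a *: x) = a * lin_coeff c x.
Proof.
have := pi_repZ (rep_e c) (rep_f c) a x ((0, 1) : C2).
by rewrite !pi_shift2 /= !mulr0 !mulr1 !add0r => -[-> _].
Qed.

(** The second column of a matrix is the image of a unit vector. *)
Lemma lin_coeff_le c x : unit_ball_coeffs c ->
  absq (augm x) + absq (lin_coeff c x) <= univ_norm x ^+ 2.
Proof.
move=> c1; have := @pi_rep_univ_le _ (plane R) _ _ x ((0, 1) : C2) (shift2_rep c1).
rewrite -(@ler_pXn2r _ 2) ?nnegrE ?mulr_ge0 ?hnorm_ge0 ?univ_norm_ge0 //.
rewrite exprMn !plane_normE pi_shift2 /= !mulr0 !mulr1 !add0r absq0 add0r.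
by rewrite /absq /= expr1n expr0n addr0 mulr1 addrC.
Qed.

Lemma lin_coeff_comb c x : lin_coeff c x =
  \sum_l c l * lin_coeff (fun l' => (l' == l)%:R) x.
Proof.
under eq_bigr do rewrite mulr_sumr; rewrite exchange_big /=.
apply: eq_bigr => w _; case: (repr w) => [|l [|l' u]].
- by rewrite mulr0 big1 // => l _; rewrite !mulr0.
- rewrite (bigD1 l) //= eqxx mulr1 mulrC big1 ?addr0 // => l' /negbTE.
  by rewrite eq_sym => ->; rewrite !mulr0.
- by rewrite mulr0 big1 // => l'' _; rewrite !mulr0.
Qed.

Definition gen (l : letter) : P := mkmalgU (cls [:: l]) 1.

Lemma augm_lin_coeff_gen c l : augm (gen l) = 0 /\ lin_coeff c (gen l) = c l.
Proof.
have rl : repr (cls [:: l]) = [:: l].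
  have /flip_congP[] := repr_cls [:: l].
  case: (repr _) => [|l' [|//]] //= eqc [eqi]; congr [:: _].
  by move: eqc eqi; case: l l' => i [] j //= _ ->.
have := pi_repU (rep_e c) (rep_f c) 1 (cls [:: l]) ((0, 1) : C2).
rewrite -/(gen l) pi_shift2 rl word_shift2 scale1r /shift2 /= !mulr0 !mulr1.
by rewrite !add0r => -[-> ->].
Qed.

End DegreeOne.

(** * Bounded functionals on a completion *)

Section ExtendFunctional.
Variables (R : realType) (P : lalgType R[i]) (nu : algSeminorm P).
Local Notation cpi := (\pi_({ideal_quot (null_ideal nu)})%qT).
Implicit Types (phi : P -> R[i]) (t s : completion nu) (x y : P).

(** Bounds are stated with squared moduli, in the form in which they are proved
    and pass to the limit. *)
Record bounded_functional phi : Prop := BoundedFunctional {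
  bf_add : forall x y, phi (x + y) = phi x + phi y;
  bf_scale : forall c x, phi (c *: x) = c * phi x;
  bf_le : forall x, absq (phi x) <= nu x ^+ 2 }.

Definition ext phi t : R[i] := clim (fun n => phi (cauchy_val (repr t) n)).

Section Theory.
Variable phi : P -> R[i].
Hypothesis bphi : bounded_functional phi.

Lemma bfB x y : phi (x - y) = phi x - phi y.
Proof. by rewrite -scaleN1r bf_add // bf_scale // mulN1r. Qed.

Lemma bf_normc x : Normc.normc (phi x) <= nu x.
Proof.
by rewrite -(@ler_pXn2r _ 2) ?nnegrE ?normc_ge0 ?asnorm_ge0 // normc_sqr bf_le.
Qed.

(** The extension is computed along any Cauchy sequence of the class, since two
    of them differ by a null sequence. *)
Lemma ext_cvg (u : cauchySeq nu) :
  ccvg (fun n => phi (cauchy_val u n)) (ext phi (cpi u)).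
Proof.
have /clim_cvg cr : cauchy_seq (@Normc.normc R)
    (fun n => phi (cauchy_val (repr (cpi u : completion nu)) n)).
  move=> e e0; have [N h] := asboolW (cauchy_valP (repr (cpi u))) e e0.
  exists N => i j iN jN; rewrite -bfB.
  exact: le_lt_trans (bf_normc _) (h _ _ iN jN).
have /asboolP ru0 : null_pred (repr (cpi u) - u) := cpi_repr u.
have d0 : ccvg (fun n => phi (cauchy_val (repr (cpi u) - u) n)) 0.
  apply: ccvg0; apply: (squeeze_cvgr _ (cvg_cst 0) ru0); apply: nearW => n.
  by rewrite normc_ge0 bf_normc.
have := ccvgD cr (ccvgM (ccvg_cst (-1)) d0); rewrite mulr0 addr0.
have -> // : (fun n => phi (cauchy_val (repr (cpi u : completion nu)) n) +
    -1 * phi (cauchy_val (repr (cpi u) - u) n)) = (fun n => phi (cauchy_val u n)).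
by apply/funext => n; rewrite mulN1r bfB opprB addrC subrK.
Qed.

Lemma ext_add t s : ext phi (t + s) = ext phi t + ext phi s.
Proof.
elim/cpi_ind: t => u; elim/cpi_ind: s => v; rewrite -cpiD.
apply: ccvg_unique (ext_cvg _) _.
have := ccvgD (ext_cvg u) (ext_cvg v).
by under eq_fun do rewrite -(bf_add bphi).
Qed.

Lemma ext_scale c t : ext phi (c *: t) = c * ext phi t.
Proof.
elim/cpi_ind: t => u.
have -> : c *: (cpi u : completion nu) = cpi (c *: u) by exact: cpiZ.
apply: ccvg_unique (ext_cvg _) _.
have := ccvgM (ccvg_cst c) (ext_cvg u).
by under eq_fun do rewrite -(bf_scale bphi).
Qed.

Lemma ext_to x : ext phi (to_completion nu x) = phi x.
Proof. by apply: ccvg_unique (ext_cvg _) _; exact: ccvg_cst. Qed.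

End Theory.

Lemma ext_comb_le (I : finType) (phi : I -> P -> R[i]) (c : I -> R[i]) t :
  (forall i, bounded_functional (phi i)) ->
  (forall x, absq (\sum_i c i * phi i x) <= nu x ^+ 2) ->
  absq (\sum_i c i * ext (phi i) t) <= completion_norm t ^+ 2.
Proof.
move=> bphi cphi; elim/cpi_ind: t => u.
have cu : ccvg (fun n => \sum_i c i * phi i (cauchy_val u n))
    (\sum_i c i * ext (phi i) (cpi u)).
  by apply: ccvg_sum => i; apply: ccvgM (ccvg_cst _) (ext_cvg _ _).
have /cauchy_norm_cvg nc := asboolW (cauchy_valP u).
rewrite completion_norm_pi expr2.
apply: (ler_cvg_to (ccvg_absq cu) (cvgM nc nc)).
by apply: nearW => n; rewrite (le_trans (cphi _)) // expr2.
Qed.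

(** A character and a derivation at it extend as such. *)
Lemma ext_product phi psi (bphi : bounded_functional phi)
    (bpsi : bounded_functional psi) t s :
  (forall x y, phi (x * y) = phi x * phi y) ->
  (forall x y, psi (x * y) = phi x * psi y + psi x * phi y) ->
  ext phi (t * s) = ext phi t * ext phi s /\
  ext psi (t * s) = ext phi t * ext psi s + ext psi t * ext phi s.
Proof.
move=> phiM psiM; elim/cpi_ind: t => u; elim/cpi_ind: s => v.
have -> : (cpi u : completion nu) * cpi v = cpi (u * v) by exact: cpiM.
split; [apply: ccvg_unique (ext_cvg bphi _) _|
  apply: ccvg_unique (ext_cvg bpsi _) _].
  have := ccvgM (ext_cvg bphi u) (ext_cvg bphi v).
  by under eq_fun do rewrite -phiM.
have := ccvgD (ccvgM (ext_cvg bphi u) (ext_cvg bpsi v))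
  (ccvgM (ext_cvg bpsi u) (ext_cvg bphi v)).
by under eq_fun do rewrite -psiM.
Qed.

End ExtendFunctional.

(** * Degree at most one in the tensor algebra *)

Section TensorDegreeOne.
Variable R : realType.
Local Notation P := (malg Ftheta R[i]).
Local Notation T := (tensor_algebra R).
Local Notation nu := (univ_seminorm R).
Implicit Types (x y : P) (t s : T) (c g : letter -> R[i]) (l : letter).

Definition vnorm (v : 'I_2 -> R[i]) : R := Num.sqrt (\sum_i absq (v i)).

Lemma vnorm_ge0 (v : 'I_2 -> R[i]) : 0 <= vnorm v.
Proof. exact: sqrtr_ge0. Qed.

Lemma vnorm_sqr (v : 'I_2 -> R[i]) : vnorm v ^+ 2 = \sum_i absq (v i).
Proof. by rewrite sqr_sqrtr // sumr_ge0 // => i _; exact: absq_ge0. Qed.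

Definition dirac_coeffs l : letter -> R[i] := fun l' => (l' == l)%:R.

Lemma dirac_coeffs_unit_ball l : unit_ball_coeffs (dirac_coeffs l).
Proof.
have a1 (b : bool) : absq (b%:R : R[i]) = b%:R.
  by case: b; rewrite ?absq1 ?absq0.
by split; under eq_bigr do rewrite a1; rewrite big_ord_recl big_ord1;
  case: l => [[[|[|//]] ?]|[[|[|//]] ?]]; rewrite ?addr0 ?add0r ?ler01.
Qed.

Lemma augm_bounded : bounded_functional nu (@augm R).
Proof.
split=> [x y|c x|x]; [exact: augm_add|exact: augm_scale|].
apply: le_trans (lin_coeff_le x (dirac_coeffs_unit_ball (e_ ord0))).
by rewrite lerDl absq_ge0.
Qed.

Lemma lin_coeff_bounded c : unit_ball_coeffs c ->
  bounded_functional nu (lin_coeff c).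
Proof.
move=> c1; split=> [x y|a x|x]; [exact: lin_coeff_add|exact: lin_coeff_scale|].
by apply: le_trans (lin_coeff_le x c1); rewrite lerDr absq_ge0.
Qed.

Definition taugm t : R[i] := ext (nu := nu) (@augm R) t.
Definition tlin l t : R[i] := ext (nu := nu) (lin_coeff (dirac_coeffs l)) t.

Let bdir l := lin_coeff_bounded (dirac_coeffs_unit_ball l).

Lemma taugmD t s : taugm (t + s) = taugm t + taugm s.
Proof. exact: (ext_add augm_bounded). Qed.

Lemma taugmZ a t : taugm (a *: t) = a * taugm t.
Proof. exact: (ext_scale augm_bounded). Qed.

Lemma tlinD l t s : tlin l (t + s) = tlin l t + tlin l s.
Proof. exact: (ext_add (bdir l)). Qed.

Lemma tlinZ l a t : tlin l (a *: t) = a * tlin l t.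
Proof. exact: (ext_scale (bdir l)). Qed.

Lemma taugm_tlinM l t s : taugm (t * s) = taugm t * taugm s /\
  tlin l (t * s) = taugm t * tlin l s + tlin l t * taugm s.
Proof.
by apply: (ext_product augm_bounded (bdir l)) => x y;
  have [] := augm_lin_coeff_mul x y (dirac_coeffs_unit_ball l).
Qed.

Lemma taugm_le t : absq (taugm t) <= tensor_norm t ^+ 2.
Proof.
have := @ext_comb_le _ _ nu 'I_1 (fun=> @augm R) (fun=> 1) t (fun=> augm_bounded).
rewrite big_ord1 mul1r; apply => x; rewrite big_ord1 mul1r.
exact: (bf_le augm_bounded).
Qed.

Lemma tlin_comb_le c t : unit_ball_coeffs c ->
  absq (\sum_l c l * tlin l t) <= tensor_norm t ^+ 2.
Proof.
move=> c1; apply: (ext_comb_le _ bdir) => x.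
by rewrite -lin_coeff_comb; exact: bf_le (lin_coeff_bounded c1) x.
Qed.

Lemma tlin_le l t : absq (tlin l t) <= tensor_norm t ^+ 2.
Proof.
have := tlin_comb_le t (dirac_coeffs_unit_ball l).
rewrite (bigD1 l) //= /dirac_coeffs eqxx.
by rewrite mul1r big1 ?addr0 // => l' /negbTE ->; rewrite mul0r.
Qed.

Lemma tensor_norm_ge0 t : 0 <= tensor_norm t.
Proof.
elim/cpi_ind: t => u; rewrite /tensor_norm completion_norm_pi.
apply: limr_ge; first exact/cauchy_norm_cvg/(asboolW (cauchy_valP u)).
by apply: nearW => n; exact: asnorm_ge0.
Qed.

(** Apply the bound for [unit_ball_coeffs] to the weights that are dual to the
    degree-one coefficients of [t], normalized on the [e] and the [f] part
    separately. *)
Lemma tlin_vnorm_le t :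
  vnorm (fun i => tlin (e_ i) t) + vnorm (fun j => tlin (f_ j) t) <= tensor_norm t.
Proof.
pose dual (v : 'I_2 -> R[i]) i := Complex (vnorm v)^-1 0 * conjc (v i).
have dual1 v : \sum_i absq (dual v i) <= 1.
  under eq_bigr do rewrite absqM.
  under eq_bigr do rewrite absqJ.
  rewrite -mulr_sumr -vnorm_sqr absq_real -exprMn.
  have [->|v0] := eqVneq (vnorm v) 0; first by rewrite mulr0 expr0n ler01.
  by rewrite mulVf // expr1n.
have dualE v : \sum_i dual v i * v i = Complex (vnorm v) 0.
  under eq_bigr do rewrite -mulrA [conjc _ * _]mulrC mul_conj.
  rewrite -mulr_sumr.
  have -> : \sum_i Complex (absq (v i)) 0 = Complex (vnorm v ^+ 2) 0 :> R[i].
    by rewrite vnorm_sqr !big_ord_recl !big_ord0; simpc; rewrite ?addr0.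
  simpc; congr Complex; have [->|v0] := eqVneq (vnorm v) 0.
    by rewrite expr0n mulr0.
  by rewrite expr2 mulKf.
pose c l := match l with
  | inl i => dual (fun i => tlin (e_ i) t) i
  | inr j => dual (fun j => tlin (f_ j) t) j end.
have := @tlin_comb_le c t (conj (dual1 _) (dual1 _)).
rewrite big_sumType /= !dualE; simpc; rewrite /absq /= expr0n addr0.
by rewrite ler_pXn2r ?nnegrE ?addr_ge0 ?vnorm_ge0 ?tensor_norm_ge0.
Qed.

Definition lin_elt g : P := \sum_l g l *: gen R l.

(** A row contraction applied to the vector with entries [v i *: h] has norm at
    most [vnorm v] times the norm of [h]. *)
Lemma univ_norm_lin_elt g : univ_norm (lin_elt g) <=
  vnorm (fun i => g (e_ i)) + vnorm (fun j => g (f_ j)).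
Proof.
apply: univ_norm_le => [|H A B AB]; first by rewrite addr_ge0 ?vnorm_ge0.
apply: opnorm_le => [|h]; first by rewrite addr_ge0 ?vnorm_ge0.
have genE l : pi_rep A B (gen R l) h = letter_op A B l h.
  rewrite /gen pi_repU scale1r.
  by rewrite (word_op_cong AB h (repr_cls [:: l])).
have row (X : 'I_2 -> {linear H -> H}) (v : 'I_2 -> R[i]) : row_contraction X ->
    hnorm (\sum_i v i *: X i h) <= vnorm v * hnorm h.
  move=> rX; rewrite -(@ler_pXn2r _ 2) ?nnegrE ?mulr_ge0 ?hnorm_ge0 ?vnorm_ge0 //.
  rewrite exprMn vnorm_sqr mulr_suml.
  have -> : \sum_i v i *: X i h = \sum_i X i (v i *: h).
    by apply: eq_bigr => i _; rewrite linearZ.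
  apply: le_trans (rX (fun i => v i *: h)) _.
  by apply: ler_sum => i _; rewrite hnormZ exprMn normc_sqr.
rewrite /lin_elt pi_rep_sum.
under eq_bigr do rewrite pi_repZ genE.
rewrite big_sumType /= mulrDl; apply: le_trans (Defs.hnormD _ _) _.
by case: AB => rA rB _; apply: lerD; exact: row.
Qed.

Definition tlin_elt g : T := to_completion nu (lin_elt g).

Lemma tlin_tlin_elt g l : tlin l (tlin_elt g) = g l.
Proof.
rewrite /tlin /tlin_elt (ext_to (bdir l)) /lin_elt.
have -> : lin_coeff (dirac_coeffs l) (\sum_l' g l' *: gen R l') =
    \sum_l' g l' * lin_coeff (dirac_coeffs l) (gen R l').
  rewrite (big_morph _ (lin_coeff_add (dirac_coeffs l)) (_ : _ = 0)).
    by apply: eq_bigr => l' _; rewrite lin_coeff_scale.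
  by rewrite -(scale0r (gen R l)) lin_coeff_scale mul0r.
rewrite (bigD1 l) //= (augm_lin_coeff_gen _ l).2 /dirac_coeffs eqxx mulr1.
rewrite big1 ?addr0 //.
by move=> l' /negbTE ll'; rewrite (augm_lin_coeff_gen _ l').2 ll' mulr0.
Qed.

Lemma tensor_norm_tlin_elt g : tensor_norm (tlin_elt g) <=
  vnorm (fun i => g (e_ i)) + vnorm (fun j => g (f_ j)).
Proof. by rewrite /tensor_norm completion_norm_to univ_norm_lin_elt. Qed.

End TensorDegreeOne.

(** * Coordinates on ell^2 *)

Lemma count_nform k (s : seq 'I_2) : (k <= size s)%N -> count is_e (nform k s) = k.
Proof.
move=> ks; rewrite /nform count_cat !count_map.
rewrite (eq_count (a2 := predT)) // count_predT size_take_min.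
by rewrite (eq_count (a2 := pred0)) // count_pred0 addn0 (minn_idPl ks).
Qed.

Lemma idx_nform k (s : seq 'I_2) : map letter_idx (nform k s) = s.
Proof.
rewrite /nform map_cat -!map_comp !(@eq_map _ _ _ idfun) // !map_id.
exact: cat_take_drop.
Qed.

(** A word of the semigroup is determined by its sequence of indices [s] and by
    its number [k] of letters [e], subject only to [k <= size s]. *)
Definition pt (k : nat) (s : seq 'I_2) : Ftheta := cls (nform k s).

Lemma pt_inj k k' s s' : (k <= size s)%N -> (k' <= size s')%N ->
  pt k s = pt k' s' -> k = k' /\ s = s'.
Proof. by move=> ks ks' /clsP/flip_congP; rewrite !count_nform ?idx_nform. Qed.

Lemma pt_cls u : cls u = pt (count is_e u) (map letter_idx u).
Proof. exact/clsP/flip_nform. Qed.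

Lemma ptP (w : Ftheta) : exists s k, (k <= size s)%N /\ w = pt k s.
Proof.
rewrite -(cls_repr w) pt_cls; set u := repr w.
by exists (map letter_idx u), (count is_e u); rewrite size_map count_size.
Qed.

Fixpoint words (N : nat) : seq (seq 'I_2) :=
  if N is N'.+1 then [::] :: [seq i :: s | i <- enum 'I_2, s <- words N'] else [::].

Lemma mem_words N s : (s \in words N) = (size s < N)%N.
Proof.
elim: N s => [//|N IHN] [|i s]; rewrite inE //=.
apply/idP/idP => [/allpairsP[[j t] /= [_]]|sN].
  by rewrite IHN => tN [_ ->]; rewrite ltnS.
by apply/allpairsP; exists (i, s); rewrite mem_enum /= IHN -ltnS.
Qed.

Lemma words_uniq N : uniq (words N).
Proof.
elim: N => //= N IHN; rewrite allpairs_uniq ?enum_uniq ?andbT //.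
  by apply/allpairsP => -[[? ?] /= [_ _]].
by move=> [? ?] [? ?] _ _ /= [-> ->].
Qed.

Lemma sum_words_le (R : realType) N (t : seq (seq 'I_2)) (F : seq 'I_2 -> R) :
  (forall s, 0 <= F s) -> uniq t -> {subset t <= words N} ->
  \sum_(s <- t) F s <= \sum_(s <- words N) F s.
Proof.
move=> F0 ut tN; rewrite [leRHS](bigID (mem t)) /=.
rewrite -[X in _ <= X + _]big_filter.
have -> : \sum_(i <- [seq i <- words N | i \in t]) F i = \sum_(i <- t) F i.
  apply/perm_big/uniq_perm; rewrite ?filter_uniq ?words_uniq // => s.
  by rewrite mem_filter; case: (boolP (s \in t)) => // /tN ->.
by rewrite lerDl sumr_ge0.
Qed.

Section Coordinates.
Variable R : realType.
Implicit Types (f g : ell2 R) (s : seq 'I_2) (k : nat) (c : R[i]).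

(** The coordinate of [f] at [pt k s], extended by 0 to all [k]: with this
    convention the generators act without boundary cases. *)
Definition co (f : Ftheta -> R[i]^o) s k : R[i] :=
  if (k <= size s)%N then f (pt k s) else 0.

(** The coordinates after the shift of [k] by one. *)
Definition coS (f : Ftheta -> R[i]^o) s k : R[i] :=
  if k is k'.+1 then co f s k' else 0.

Lemma co_ext f g : (forall s k, co f s k = co g s k) -> f = g.
Proof.
move=> fg; apply/val_inj/funext => w; have [s [k [ks ->]]] := ptP w.
by have := fg s k; rewrite /co ks.
Qed.

Lemma coD f g s k : co (f + g) s k = co f s k + co g s k.
Proof. by rewrite /co; case: ifP; rewrite ?addr0. Qed.

Lemma coZ c f s k : co (c *: f) s k = c * co f s k.
Proof. by rewrite /co; case: ifP; rewrite ?mulr0. Qed.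

Lemma co0 s k : co (0 : ell2 R) s k = 0.
Proof. by rewrite -(scale0r (0 : ell2 R)) coZ mul0r. Qed.

Lemma coB f g s k : co (f - g) s k = co f s k - co g s k.
Proof. by rewrite -scaleN1r coD coZ mulN1r. Qed.

Lemma co_sum (I : Type) (r : seq I) (F : I -> ell2 R) s k :
  co (\sum_(i <- r) F i) s k = \sum_(i <- r) co (F i) s k.
Proof.
elim: r => [|i r IHr]; first by rewrite !big_nil co0.
by rewrite !big_cons coD IHr.
Qed.

Lemma co_xi s k s' k' : (k <= size s)%N ->
  co (xi R (pt k s)) s' k' = ((s' == s) && (k' == k))%:R.
Proof.
move=> ks; rewrite /co; case: ifPn => ks'.
  rewrite /= /delta; congr (nat_of_bool _)%:R; apply/eqP/andP => [|[/eqP-> /eqP-> //]].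
  by move/(pt_inj ks' ks) => [-> ->].
suff /negbTE -> : ~~ ((s' == s) && (k' == k)) by [].
by apply: contra ks' => /andP[/eqP -> /eqP ->].
Qed.

(** In coordinates, [f_i] prepends the index [i], and [e_i] also shifts [k]. *)
Lemma co_lambda (l : letter) f s k : co (lambda (cls [:: l]) f) s k =
  match s with
  | [::] => 0
  | i :: s' => if letter_idx l == i then
      (if is_e l then coS f s' k else co f s' k) else 0
  end.
Proof.
have out s' k' : (forall y, pt k' s' = mulF (cls [:: l]) y -> False) ->
    co (lambda (cls [:: l]) f) s' k' = 0.
  move=> h; rewrite /co; case: ifP => // _ /=; rewrite /left_shift.
  by case: pselect => // wy; exfalso; case: wy => y; exact: h.
have outN s' k' : (k' <= size s')%N ->
    (forall t m, (m <= size t)%N -> k' = (is_e l + m)%N ->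
       s' = letter_idx l :: t -> False) ->
    co (lambda (cls [:: l]) f) s' k' = 0.
  move=> ks' h; apply: out => y; have [t [m [mt ->]]] := ptP y.
  rewrite /pt mulF_cls => /clsP/flip_congP[] /=.
  rewrite !idx_nform !count_nform //; exact: h.
have inN t m : (m <= size t)%N ->
    co (lambda (cls [:: l]) f) (letter_idx l :: t) (is_e l + m) = f (pt m t).
  move=> mt; rewrite /co /= ifT; last by case: (is_e l) => //; exact: leqW.
  have -> : pt (is_e l + m) (letter_idx l :: t) = mulF (cls [:: l]) (pt m t).
    by rewrite /pt mulF_cls [RHS]pt_cls /= idx_nform count_nform.
  exact: left_shift_mul.
have [ks|ks] := leqP k (size s); last first.
  rewrite /co leqNgt ks /=; case: s ks => // i s /= ks.
  case: ifP => // _; case: ifP => _.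
    by case: k ks => //= k; rewrite ltnS => ks; rewrite /co (leqNgt k) ks.
  by rewrite /co leqNgt (ltnW ks).
case: s ks => [|i s] ks; first by apply: outN.
case: eqP => [<-|li]; last by apply: outN => // t m _ _ [/esym].
case: (boolP (is_e l)) => le.
  case: k ks => [|k] ks; first by apply: outN => // t m _; rewrite le.
  by have := inN s k; rewrite le /= /co ltnS => ->; rewrite // -ltnS ks.
case: (leqP k (size s)) => [ks'|ks'].
  by have := inN s k ks'; rewrite (negbTE le) add0n => ->; rewrite /co ks'.
rewrite [RHS]/co leqNgt ks' /=; apply: outN => // t m mt.
by rewrite (negbTE le) add0n => km [st]; move: ks'; rewrite km st ltnNge mt.
Qed.

(** The finite sums over [words N] are cofinal among the finite partial sums of
    the squared norm, and the recursion of [words] splits off the first index. *)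
Definition sumsq (N : nat) f : R :=
  \sum_(s <- words N) \sum_(k < (size s).+1) absq (co f s k).

Lemma sumsq_uniq N f : exists t, [/\ uniq t,
  forall s k, (size s < N)%N -> (k <= size s)%N -> pt k s \in t &
  sumsq N f = \sum_(w <- t) absq (f w)].
Proof.
exists [seq pt k s | s <- words N, k <- iota 0 (size s).+1]; split.
- apply: (@allpairs_uniq_dep _ (fun=> nat) _ (fun s k => pt k s)).
  + exact: words_uniq.
  + by move=> s _; exact: iota_uniq.
  have st_le (p : {_ : seq 'I_2 & nat}) :
      p \in [seq existT (fun=> nat) s k | s <- words N, k <- iota 0 (size s).+1] ->
      (tagged p <= size (tag p))%N.
    move=> /allpairsPdep[s [k [_ + ->]]].
    by rewrite mem_iota add0n ltnS => /andP[].
  move=> [s k] [s' k'] /st_le /= ks /st_le /= ks'.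
  by move=> /(pt_inj ks ks')[-> ->].
- move=> s k sN ks; apply/allpairsPdep; exists s, k.
  by rewrite mem_words mem_iota add0n ltnS.
- rewrite big_allpairs_dep; apply: eq_bigr => s _ /=.
  rewrite -(big_mkord xpredT (fun k => absq (co f s k))) /index_iota subn0.
  by apply: eq_big_seq => k; rewrite mem_iota add0n ltnS /co /= => ->.
Qed.

Lemma sqsumE f : sqsum f = (ell2_norm f ^+ 2)%:E.
Proof.
have s0 : (0 <= sqsum f)%E by apply: esum_ge0 => w _; rewrite lee_fin sqr_ge0.
rewrite /ell2_norm sqr_sqrtr ?fine_ge0 // fineK // ge0_fin_numE //.
exact: ell2_valP.
Qed.

Lemma ell2_norm_ge0 f : 0 <= ell2_norm f.
Proof. exact: sqrtr_ge0. Qed.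

Lemma sum_le_norm f (t : seq Ftheta) : uniq t ->
  \sum_(w <- t) absq (f w) <= ell2_norm f ^+ 2.
Proof.
move=> ut; under eq_bigr do rewrite -normc_sqr.
rewrite -lee_fin -sqsumE -sumEFin; apply: esum_ge.
exists [set` t] => /=; first by split => //; exact: finite_seq.
by rewrite fsbig_seq.
Qed.

Lemma norm_le_sum f (M : R) :
  (forall t : seq Ftheta, uniq t -> \sum_(w <- t) absq (f w) <= M) ->
  ell2_norm f ^+ 2 <= M.
Proof.
move=> h; rewrite -lee_fin -sqsumE; apply: ge_ereal_sup => _ [X [finX _] <-].
rewrite fsbig_finite //= sumEFin lee_fin.
under eq_bigr do rewrite normc_sqr.
exact/h/fset_uniq.
Qed.

Lemma sumsq_le f N : sumsq N f <= ell2_norm f ^+ 2.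
Proof. by have [t [ut _ ->]] := sumsq_uniq N f; exact: sum_le_norm. Qed.

Lemma ell2_sqnorm_le f (M : R) : (forall N, sumsq N f <= M) -> ell2_norm f ^+ 2 <= M.
Proof.
move=> h; apply: norm_le_sum => t ut.
have [N tN] : exists N, forall s k, (k <= size s)%N -> pt k s \in t -> (size s < N)%N.
  exists (\max_(w <- t) (size (repr w))).+1 => s k ks kst; rewrite ltnS.
  have -> : size s = size (repr (pt k s)).
    have /flip_cong_size -> := repr_cls (nform k s).
    by rewrite /nform size_cat !size_map -size_cat cat_take_drop.
  exact: (@leq_bigmax_seq _ t xpredT (fun w => size (repr w))).
apply: le_trans (h N); have [t' [ut' t'P ->]] := sumsq_uniq N f.
rewrite [leRHS](bigID (mem t)) /= -[X in _ <= X + _]big_filter.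
have -> : \sum_(i <- [seq i <- t' | i \in t]) absq (f i) = \sum_(i <- t) absq (f i).
  apply/perm_big/uniq_perm; rewrite ?filter_uniq // => w.
  rewrite mem_filter; case: (boolP (w \in t)) => //=.
  have [s [k [ks ->]]] := ptP w => wt; rewrite t'P //; exact: tN wt.
by rewrite lerDl sumr_ge0 // => w _; exact: absq_ge0.
Qed.

Lemma co_le f s k : absq (co f s k) <= ell2_norm f ^+ 2.
Proof.
rewrite /co; case: ifP => _; last by rewrite absq0 sqr_ge0.
by have := @sum_le_norm f [:: pt k s] isT; rewrite big_seq1.
Qed.

Lemma ell2_norm0 : ell2_norm (0 : ell2 R) = 0.
Proof.
apply/eqP; rewrite -sqrf_eq0 eq_le sqr_ge0 andbT; apply: ell2_sqnorm_le => N.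
by rewrite /sumsq big1 // => s _; rewrite big1 // => k _; rewrite co0 absq0.
Qed.

Lemma ell2_normZ c f : ell2_norm (c *: f) = Normc.normc c * ell2_norm f.
Proof.
have le a g : ell2_norm (a *: g) ^+ 2 <= absq a * ell2_norm g ^+ 2.
  apply: ell2_sqnorm_le => N; apply: (@le_trans _ _ (absq a * sumsq N g)).
    rewrite /sumsq mulr_sumr; apply: ler_sum => s _; rewrite mulr_sumr.
    by apply: ler_sum => k _; rewrite coZ absqM.
  by rewrite ler_wpM2l ?absq_ge0 ?sumsq_le.
apply/eqP; rewrite -(@eqrXn2 _ 2) ?ell2_norm_ge0 ?mulr_ge0 ?normc_ge0 ?ell2_norm_ge0 //.
rewrite exprMn normc_sqr eq_le le /=.
have [->|c0] := eqVneq c 0; first by rewrite absq0 mul0r sqr_ge0.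
have := le c^-1 (c *: f); rewrite scalerA mulVf // scale1r => h.
have cc : absq c * absq c^-1 = 1.
  by rewrite -absqM mulfV // /absq /= expr1n expr0n addr0.
apply: le_trans (ler_wpM2l (absq_ge0 c) h) _.
by rewrite mulrA cc mul1r.
Qed.

(** A crude form of the triangle inequality, enough to see that sums of bounded
    operators are bounded. *)
Lemma ell2_normD f g :
  ell2_norm (f + g) ^+ 2 <= 2 * ell2_norm f ^+ 2 + 2 * ell2_norm g ^+ 2.
Proof.
apply: ell2_sqnorm_le => N; apply: (@le_trans _ _ (2 * sumsq N f + 2 * sumsq N g)).
  rewrite /sumsq !mulr_sumr -big_split; apply: ler_sum => s _ /=.
  rewrite !mulr_sumr -big_split; apply: ler_sum => k _ /=; rewrite coD.
  case: (co f s k) (co g s k) => a b [a' b']; rewrite /absq /=.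
  have := sqr_ge0 (a - a'); have := sqr_ge0 (b - b'); nra.
by rewrite lerD ?ler_pM2l ?sumsq_le.
Qed.

End Coordinates.

(** * Bounded operators on ell^2 and the algebra they generate *)

Section Ell2Operators.
Variable R : realType.
Implicit Types (f g : ell2 R) (S T : ell2 R -> ell2 R) (c : R[i]).
Local Notation N := (@ell2_norm R).

Section LinearOperator.
Variable T : ell2 R -> ell2 R.
Hypothesis linT : linear T.

Lemma opD f g : T (f + g) = T f + T g.
Proof. by rewrite -[f]scale1r linT !scale1r. Qed.

Lemma op0 : T 0 = 0.
Proof. by apply: (addrI (T 0)); rewrite -opD !addr0. Qed.

Lemma opZ c f : T (c *: f) = c *: T f.
Proof. by rewrite -[c *: f]addr0 linT op0 addr0. Qed.

End LinearOperator.

Lemma ell2_opnorm_ge T f : bounded_op N T -> N f <= 1 -> N (T f) <= opnorm N T.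
Proof.
move=> [_ [M TM]] f1; apply: ub_le_sup; last by exists f.
exists `|M| => _ [g /= g1 <-]; apply: le_trans (TM g) _.
apply: le_trans (_ : `|M| * N g <= _).
  by rewrite ler_wpM2r ?ell2_norm_ge0 // ler_norm.
by rewrite -[leRHS]mulr1 ler_wpM2l.
Qed.

Lemma ell2_norm_eq0 f : N f = 0 -> f = 0.
Proof.
move=> f0; apply: co_ext => s k; rewrite co0; apply: absq_eq0.
by apply/eqP; rewrite eq_le absq_ge0 andbT; have := co_le f s k; rewrite f0 expr0n.
Qed.

Lemma ell2_opnormP T f : bounded_op N T -> N (T f) <= opnorm N T * N f.
Proof.
move=> bT; have [linT _] := bT.
have [f0|f0] := eqVneq (N f) 0.
  by rewrite (ell2_norm_eq0 f0) op0 // !ell2_norm0 mulr0.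
have fgt0 : 0 < N f by rewrite lt_def f0 ell2_norm_ge0.
have cE : Normc.normc (Complex (N f)^-1 0) = (N f)^-1.
  by rewrite /= expr0n addr0 sqrtr_sqr ger0_norm // invr_ge0 ltW.
have := ell2_opnorm_ge (f := Complex (N f)^-1 0 *: f) bT.
rewrite opZ // !ell2_normZ cE mulVf // => /(_ (lexx _)).
by rewrite mulrC ler_pdivrMr.
Qed.

Lemma ell2_opnorm_ge0 T : bounded_op N T -> 0 <= opnorm N T.
Proof.
move=> bT; apply: le_trans (ell2_opnorm_ge (f := 0) bT _); rewrite ?ell2_norm_ge0 //.
by rewrite ell2_norm0.
Qed.

Lemma ell2_opnorm_le T M : 0 <= M -> (forall f, N (T f) <= M * N f) ->
  opnorm N T <= M.
Proof.
move=> M0 TM; apply: ge_sup.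
  by exists (N (T 0)), 0 => //=; rewrite ell2_norm0.
move=> _ [f /= f1 <-]; apply: le_trans (TM f) _.
by rewrite -[leRHS]mulr1 ler_wpM2l.
Qed.

Lemma co_op_le T f s k : bounded_op N T ->
  absq (co (T f) s k) <= (opnorm N T * N f) ^+ 2.
Proof.
move=> bT; apply: le_trans (co_le _ _ _) _.
by rewrite ler_pXn2r ?nnegrE ?mulr_ge0 ?ell2_norm_ge0 ?ell2_opnorm_ge0 ?ell2_opnormP.
Qed.

Lemma bounded_op_add S T :
  bounded_op N S -> bounded_op N T -> bounded_op N (S \+ T).
Proof.
move=> [linS [M SM]] [linT [K TK]]; split=> [c f g|].
  by rewrite /= linS linT scalerDr addrACA.
exists (2 * `|M| + 2 * `|K|) => f.
have le0 : 0 <= 2 * `|M| + 2 * `|K| by rewrite addr_ge0 ?mulr_ge0.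
rewrite -(@ler_pXn2r _ 2) ?nnegrE ?mulr_ge0 ?ell2_norm_ge0 //.
apply: le_trans (ell2_normD _ _) _.
have abs x f' : N f' <= x * N f -> N f' ^+ 2 <= `|x| ^+ 2 * N f ^+ 2.
  move=> h; rewrite -exprMn ler_pXn2r ?nnegrE ?mulr_ge0 ?ell2_norm_ge0 //.
  by apply: le_trans h _; rewrite ler_wpM2r ?ell2_norm_ge0 ?ler_norm.
have := abs _ _ (SM f); have := abs _ _ (TK f); rewrite exprMn.
have := normr_ge0 M; have := normr_ge0 K; move: (sqr_ge0 (N f)).
move: (`|M|) (`|K|) (N f ^+ 2) (N (S f) ^+ 2) (N (T f) ^+ 2) => m k n a b.
move=> n0 k0 m0 hb ha.
apply: (@le_trans _ _ ((2 * m ^+ 2 + 2 * k ^+ 2) * n)); first by lra.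
by rewrite ler_wpM2r //; nra.
Qed.

Lemma bounded_op_comp S T :
  bounded_op N S -> bounded_op N T -> bounded_op N (S \o T).
Proof.
move=> bS bT; have [linS _] := bS; have [linT [M TM]] := bT; split=> [c f g|].
  by rewrite /= linT linS.
exists (opnorm N S * opnorm N T) => f; apply: le_trans (ell2_opnormP _ bS) _.
by rewrite -mulrA ler_wpM2l ?ell2_opnorm_ge0 ?ell2_opnormP.
Qed.

Lemma bounded_op_scale c T : bounded_op N T -> bounded_op N (c \*: T).
Proof.
move=> [linT [M TM]]; split=> [a f g|].
  by rewrite /= linT scalerDr !scalerA mulrC.
exists (Normc.normc c * M) => f; rewrite /= ell2_normZ -mulrA.
by rewrite ler_wpM2l ?normc_ge0.
Qed.

Lemma bounded_op_id : bounded_op N idfun.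
Proof. by split=> //; exists 1 => f; rewrite mul1r. Qed.

Lemma bounded_op_lambda w : bounded_op N (@lambda R w).
Proof.
by split; [exact: lambda_linear|exists 1 => f; rewrite mul1r lambda_isometry].
Qed.

Lemma bounded_closed_unital_algebra : closed_unital_algebra N (bounded_op N).
Proof.
split=> //; [exact: bounded_op_id|exact: bounded_op_add|exact: bounded_op_scale|].
exact: bounded_op_comp.
Qed.

Lemma Au_closed_unital_algebra : closed_unital_algebra N (@Au R).
Proof.
split=> [T||S T AS AT|c T AT|S T AS AT|T bT clT].
- move=> /(_ (bounded_op N)); apply; split.
    exact: bounded_closed_unital_algebra.
  by move=> _ [w _ <-]; exact: bounded_op_lambda.
- by move=> D [[]].
- by move=> D DA; have [[_ _ + _ _ _] _] := DA; apply; [apply: AS|apply: AT].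
- by move=> D DA; have [[_ _ _ + _ _] _] := DA; apply; apply: AT.
- by move=> D DA; have [[_ _ _ _ + _] _] := DA; apply; [apply: AS|apply: AT].
- move=> D DA; have [[_ _ _ _ _ +] _] := DA; apply=> // e /clT[S AS Se].
  by exists S => //; apply: AS.
Qed.

Definition gen_op (l : letter) : ell2 R -> ell2 R := lambda (cls [:: l]).

Lemma Au_gen l : Au (gen_op l).
Proof. by move=> D [_]; apply; exists (cls [:: l]). Qed.

Lemma lambda_nil : lambda (cls [::]) = idfun :> (ell2 R -> ell2 R).
Proof.
apply/funext => f; apply/val_inj/funext => w /=.
by rewrite -{1}(mul1F w) left_shift_mul.
Qed.

Lemma lambda_mul v w : lambda (mulF v w) = lambda v \o lambda w :> (ell2 R -> ell2 R).
Proof.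
apply/funext => f; apply/val_inj/funext => x /=.
have [[y ->]|nx] := pselect (exists y, x = mulF (mulF v w) y).
  by rewrite left_shift_mul -mulFA !left_shift_mul.
rewrite {1}/left_shift; case: pselect => // _.
rewrite /left_shift; case: pselect => // vx.
case: (cid vx) => y /= xy; case: pselect => // wy; case: nx.
by case: wy => z yz; exists z; rewrite xy yz mulFA.
Qed.

(** Every [lambda w] is a product of operators of generators, so that the
    induction starts from the latter. *)
Lemma Au_ind (Q : (ell2 R -> ell2 R) -> Prop) :
  Q idfun -> (forall l, Q (gen_op l)) ->
  (forall S T, Au S -> Au T -> Q S -> Q T -> Q (S \+ T)) ->
  (forall c S, Au S -> Q S -> Q (c \*: S)) ->
  (forall S T, Au S -> Au T -> Q S -> Q T -> Q (S \o T)) ->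
  (forall T, Au T -> (forall e : R, 0 < e ->
     exists S, [/\ Au S, Q S & opnorm N (S \- T) < e]) -> Q T) ->
  forall S, Au S -> Q S.
Proof.
move=> Q1 Qg QD QZ QM Qcl S AS.
have [bA A1 AD AZ AM Acl] := Au_closed_unital_algebra.
suff [] : [set T | Au T /\ Q T] S by [].
apply: AS; split.
  split=> [T [/bA//]|//|U T [AU QU] [AT QT]|c T [AT QT]|U T [AU QU] [AT QT]|T bT clT].
  - by split; [exact: AD|exact: QD].
  - by split; [exact: AZ|exact: QZ].
  - by split; [exact: AM|exact: QM].
  - have AT : Au T by apply: Acl => // e /clT[U [AU _] Ue]; exists U.
    split=> //; apply: Qcl => // e /clT[U [AU QU] Ue]; by exists U.
move=> _ [w _ <-]; rewrite -(cls_repr w); elim: (repr w) => [|l u [Au_u Qu]].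
  by rewrite lambda_nil.
rewrite -[l :: u]/([:: l] ++ u) -mulF_cls lambda_mul.
split; first exact: AM (Au_gen l) Au_u.
exact: QM (Au_gen l) Au_u (Qg l) Qu.
Qed.

End Ell2Operators.

(** * Bounded functionals on the algebra A_u *)

Section AuFunctionals.
Variable R : realType.
Implicit Types (f g : ell2 R) (S T : ell2 R -> ell2 R) (c : R[i]).
Implicit Type F : (ell2 R -> ell2 R) -> R[i].
Local Notation N := (@ell2_norm R).

Lemma Au_bounded S : Au S -> bounded_op N S.
Proof. exact: (cua_bounded (Au_closed_unital_algebra R)). Qed.

Lemma Au_sub S T : Au S -> Au T -> Au (S \- T).
Proof.
move=> AS AT; have -> : S \- T = S \+ (-1) \*: T.
  by apply/funext => f; rewrite /= scaleN1r.
have A := Au_closed_unital_algebra R.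
by apply: (cua_add A) => //; exact: (cua_scale A).
Qed.

(** Differences are all that is needed for identities to pass to norm limits. *)
Definition Au_functional F : Prop :=
  (forall S T, Au S -> Au T -> F (S \- T) = F S - F T) /\
  exists K : R, forall S, Au S -> Normc.normc (F S) <= K * opnorm N S.

Lemma Au_functionalB F G : Au_functional F -> Au_functional G ->
  Au_functional (fun S => F S - G S).
Proof.
move=> [FB [K FK]] [GB [L GL]]; split=> [S T AS AT|].
  by rewrite FB // GB // !opprD !opprK addrACA.
exists (K + L) => S AS; apply: le_trans (normc_le_D _ _) _.
by rewrite normcN mulrDl lerD ?FK ?GL.
Qed.

Lemma Au_functionalZ F c : Au_functional F -> Au_functional (fun S => F S * c).
Proof.
move=> [FB [K FK]]; split=> [S T AS AT|]; first by rewrite FB // mulrBl.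
exists (K * Normc.normc c) => S AS; rewrite Normc.normcM mulrAC.
by rewrite ler_wpM2r ?normc_ge0 ?FK.
Qed.

Lemma Au_functional_sum (I : finType) (F : I -> (ell2 R -> ell2 R) -> R[i]) :
  (forall i, Au_functional (F i)) -> Au_functional (fun S => \sum_i F i S).
Proof.
move=> bF; elim: (index_enum I) => [|i r [FB [K FK]]].
  split=> [S T _ _|]; first by rewrite !big_nil subr0.
  by exists 0 => S _; rewrite big_nil Normc.normc0 mul0r.
have [FB' [K' FK']] := bF i; split=> [S T AS AT|].
  by rewrite !big_cons FB // FB' // opprD addrACA.
exists (K' + K) => S AS; rewrite big_cons mulrDl.
by apply: le_trans (normc_le_D _ _) _; rewrite lerD ?FK ?FK'.
Qed.

Lemma Au_functional_co f s k : Au_functional (fun S => co (S f) s k).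
Proof.
split=> [S T _ _|]; first by rewrite coB.
exists (N f) => S AS; rewrite mulrC.
have S0 := ell2_opnorm_ge0 (Au_bounded AS).
rewrite -(@ler_pXn2r _ 2) ?nnegrE ?normc_ge0 ?mulr_ge0 ?ell2_norm_ge0 //.
by rewrite normc_sqr co_op_le //; exact: Au_bounded.
Qed.

Lemma Au_functional_limit F T : Au_functional F -> Au T ->
  (forall e : R, 0 < e -> exists S, [/\ Au S, F S = 0 & opnorm N (S \- T) < e]) ->
  F T = 0.
Proof.
move=> [FB [K FK]] AT FT; apply: Normc.eq0_normc; apply/eqP.
rewrite eq_le normc_ge0 andbT; apply/ler_addgt0Pr => e e0; rewrite add0r.
have K1 : 0 < `|K| + 1 by rewrite ltr_wpDl.
have [S [AS FS Se]] := FT _ (divr_gt0 e0 K1).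
have AST := Au_sub AS AT.
rewrite -normcN -[- _]add0r -FS -FB //; apply: le_trans (FK _ AST) _.
apply: (@le_trans _ _ ((`|K| + 1) * opnorm N (S \- T))).
  rewrite ler_wpM2r ?ell2_opnorm_ge0 //; first exact: Au_bounded.
  by apply: le_trans (ler_norm _) _; rewrite lerDl.
by rewrite mulrC -ler_pdivlMr // ltW.
Qed.

End AuFunctionals.

(** * Elements of A_u are lower triangular for the length of words *)

Section Triangular.
Variable R : realType.
Implicit Types (f g : ell2 R) (S T : ell2 R -> ell2 R) (c : R[i]) (l : letter).

(** The vacuum vector; the first column of an element of [Au] gives its
    Fourier coefficients. *)
Definition vac : ell2 R := xi R (pt 0 [::]).

Definition coef0 S : R[i] := co (S vac) [::] 0.

(** [is_e l] is used as a number: the word [l] has one letter [e] or none. *)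
Definition coef1 l S : R[i] := co (S vac) [:: letter_idx l] (is_e l).

Definition supp_ge n (f : ell2 R) : Prop :=
  forall s k, (size s < n)%N -> co f s k = 0.

Lemma co_vac s k : co vac s k = ((s == [::]) && (k == 0%N))%:R.
Proof. exact: co_xi. Qed.

(** Elements of [Au] commute with right multiplication by words.  What is
    needed of this is the action on the two lowest degrees of a vector [f]
    supported on words of length at least [n]: the same coefficients [coef0]
    and [coef1] occur for every [n].  Stated for all [f] at once, the property
    is stable under products and norm limits. *)
Record triangular S : Prop := Triangular {
  tri_supp : forall n f, supp_ge n f -> supp_ge n (S f);
  tri_diag : forall f s k, supp_ge (size s) f -> co (S f) s k = coef0 S * co f s k;
  tri_sub : forall f i s k, supp_ge (size s) f -> co (S f) (i :: s) k =
    coef0 S * co f (i :: s) k + coef1 (e_ i) S * coS f s k +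
    coef1 (f_ i) S * co f s k }.

Lemma coef0_id : coef0 idfun = 1.
Proof. by rewrite /coef0 co_vac. Qed.

Lemma coef1_id l : coef1 l idfun = 0.
Proof. by rewrite /coef1 co_vac. Qed.

Lemma coef0_gen l : coef0 (gen_op l) = 0.
Proof. by rewrite /coef0 co_lambda. Qed.

Lemma coef1_gen l l' : coef1 l (gen_op l') = (l == l')%:R.
Proof.
rewrite /coef1 co_lambda /coS.
case: l l' => i [] j; rewrite /= ?co_vac /= ?if_same //.
  by rewrite -[inl i == inl j]/(i == j) [j == i]eq_sym; case: eqP.
by rewrite -[inr i == inr j]/(i == j) [j == i]eq_sym; case: eqP.
Qed.

Lemma coef0D S T : coef0 (S \+ T) = coef0 S + coef0 T.
Proof. exact: coD. Qed.

Lemma coef1D l S T : coef1 l (S \+ T) = coef1 l S + coef1 l T.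
Proof. exact: coD. Qed.

Lemma coef0Z c S : coef0 (c \*: S) = c * coef0 S.
Proof. exact: coZ. Qed.

Lemma coef1Z l c S : coef1 l (c \*: S) = c * coef1 l S.
Proof. exact: coZ. Qed.

(** At [n = 0] triangularity says that [coef0] is a character and that [coef1]
    consists of derivations at it. *)
Lemma coef0M S T : triangular S -> coef0 (S \o T) = coef0 S * coef0 T.
Proof. by move=> tS; rewrite /coef0 /= (tri_diag tS). Qed.

Lemma coef1M l S T : triangular S ->
  coef1 l (S \o T) = coef0 S * coef1 l T + coef1 l S * coef0 T.
Proof.
move=> tS; rewrite /coef1 /= (tri_sub tS) //.
case: l => i /=; first by rewrite {2}/co /= mulr0 addr0.
by rewrite mulr0 addr0.
Qed.

Lemma supp_geS n f : supp_ge n f -> forall s k, (size s < n)%N -> coS f s k = 0.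
Proof. by move=> fn s [//|k]; exact: fn. Qed.

Lemma Au_triangular S : Au S -> triangular S.
Proof.
move: S; apply: Au_ind.
- split=> [//|f s k _|f i s k _]; first by rewrite coef0_id mul1r.
  by rewrite coef0_id !coef1_id mul1r !mul0r !addr0.
- move=> l; split=> [n f fn [|i s] k sn|f [|i s] k fs|f i s k fs].
  + by rewrite co_lambda.
  + rewrite co_lambda; case: ifP => // _; rewrite (supp_geS fn) 1?ltnW //.
    by rewrite (fn s) 1?ltnW // if_same.
  + by rewrite co_lambda coef0_gen mul0r.
  + rewrite co_lambda coef0_gen mul0r; case: ifP => // _.
    by rewrite (supp_geS fs) // (fs s) // if_same.
  + rewrite co_lambda coef0_gen mul0r add0r !coef1_gen.
    case: l => j /=.
      rewrite -[e_ i == inl j]/(i == j) [j == i]eq_sym.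
      by case: eqP => _; rewrite ?mul1r ?mul0r ?addr0.
    rewrite -[f_ i == inr j]/(i == j) [j == i]eq_sym.
    by case: eqP => _; rewrite ?mul1r ?mul0r ?add0r.
- move=> S T _ _ tS tT; split=> [n f fn s k sn|f s k fs|f i s k fs].
  + by rewrite /= coD (tri_supp tS fn) // (tri_supp tT fn) // addr0.
  + by rewrite /= coD (tri_diag tS) // (tri_diag tT) // coef0D mulrDl.
  + rewrite /= coD (tri_sub tS) // (tri_sub tT) // coef0D !coef1D; ring.
- move=> c S _ tS; split=> [n f fn s k sn|f s k fs|f i s k fs].
  + by rewrite /= coZ (tri_supp tS fn) // mulr0.
  + by rewrite /= coZ (tri_diag tS) // coef0Z mulrA.
  + by rewrite /= coZ (tri_sub tS) // coef0Z !coef1Z; ring.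
- move=> S T _ _ tS tT; split=> [n f fn|f s k fs|f i s k fs].
  + exact/(tri_supp tS)/(tri_supp tT).
  + have Tfs : supp_ge (size s) (T f) by exact: (tri_supp tT).
    by rewrite /= (tri_diag tS k Tfs) (tri_diag tT k fs) (coef0M T tS) mulrA.
  + have Tfs : supp_ge (size s) (T f) by exact: (tri_supp tT).
    rewrite /= (tri_sub tS _ _ Tfs) (tri_sub tT _ _ fs) (coef0M T tS).
    rewrite !(coef1M _ T tS).
    have -> : coS (T f) s k = coef0 T * coS f s k.
      by case: k => [|k]; rewrite /coS ?mulr0 // (tri_diag tT).
    by rewrite (tri_diag tT k fs); ring.
- move=> T AT clT; have lim F : Au_functional F ->
      (forall S, triangular S -> F S = 0) -> F T = 0.
    move=> bF F0; apply: (Au_functional_limit bF AT) => e /clT[S [AS tS Se]].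
    by exists S; split=> //; exact: F0.
  have b0 (c : R[i]) : Au_functional (fun S => coef0 S * c).
    exact/Au_functionalZ/Au_functional_co.
  have b1 l (c : R[i]) : Au_functional (fun S => coef1 l S * c).
    exact/Au_functionalZ/Au_functional_co.
  split=> [n f fn s k sn|f s k fs|f i s k fs].
  + apply: (lim _ (Au_functional_co f s k)) => S tS.
    exact: (tri_supp tS fn).
  + apply/eqP; rewrite -subr_eq0; apply/eqP.
    apply: (lim _ (Au_functionalB (Au_functional_co f s k) (b0 _))) => S tS.
    by rewrite (tri_diag tS) // subrr.
  + apply/eqP; rewrite -subr_eq0 !opprD !addrA; apply/eqP.
    apply: (lim _ (Au_functionalB (Au_functionalB (Au_functionalB
      (Au_functional_co f (i :: s) k) (b0 _)) (b1 _ _)) (b1 _ _))) => S tS.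
    by rewrite (tri_sub tS) //; ring.
Qed.

End Triangular.

(** * The norm of A_u in degree one *)

Section DegreeOneNorm.
Variable R : realType.
Implicit Types (f g : ell2 R) (S T : ell2 R -> ell2 R) (c z : R[i]) (l : letter).
Implicit Type y : letter -> R[i].
Local Notation N := (@ell2_norm R).

Definition cross y : R[i] := \sum_i y (e_ i) * conjc (y (f_ i)).

Lemma sum_absqD y c d :
  \sum_i absq (y (e_ i) * c + y (f_ i) * d) =
  (\sum_i absq (y (e_ i))) * absq c + (\sum_i absq (y (f_ i))) * absq d +
  2 * complex.Re (cross y * (c * conjc d)).
Proof.
rewrite /cross !mulr_suml raddf_sum mulr_sumr -!big_split /=.
apply: eq_bigr => i _; rewrite absqD !absqM rmorphM /=.
congr (_ + _ + 2 * complex.Re _).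
by rewrite mulrACA.
Qed.

(** The cross terms of the two indices add up to a single scalar product, which
    is why [|<a, b>|] and not [|a| |b|] enters the norm. *)
Lemma sum_absqD_le y c d :
  \sum_i absq (y (e_ i) * c + y (f_ i) * d) <=
  (\sum_i absq (y (e_ i)) + Normc.normc (cross y)) * absq c +
  (\sum_i absq (y (f_ i)) + Normc.normc (cross y)) * absq d.
Proof.
rewrite sum_absqD; set A := \sum_i _; set B := \sum_i _.
set K := Normc.normc (cross y).
suff h : 2 * complex.Re (cross y * (c * conjc d)) <= K * (absq c + absq d).
  by move: h; rewrite mulrDr mulrDl [(B + K) * _]mulrDl; lra.
rewrite {}/K.
apply: (@le_trans _ _
  (2 * (Normc.normc (cross y) * (Normc.normc c * Normc.normc d)))).
  rewrite ler_pM2l //; apply: le_trans (ler_norm _) (le_trans (re_le_normc _) _).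
  rewrite !Normc.normcM; have -> // : Normc.normc (conjc d) = Normc.normc d.
  by case: d => a b; rewrite /= sqrrN.
rewrite mulrCA ler_wpM2l ?normc_ge0 // -!normc_sqr.
by have := sqr_ge0 (Normc.normc c - Normc.normc d); lra.
Qed.

Definition lin_op y : ell2 R -> ell2 R := fun f => \sum_l y l *: gen_op l f.

Lemma Au_lin_op y : Au (lin_op y).
Proof.
have A := Au_closed_unital_algebra R; rewrite /lin_op.
elim: (index_enum _) => [|l r IHr].
  have := cua_scale A 0 (cua_id A).
  suff -> : (fun f => \sum_(l <- [::]) y l *: gen_op l f) = 0 \*: idfun by [].
  by apply/funext => f; rewrite big_nil /= scale0r.
have := cua_add A (cua_scale A (y l) (Au_gen (R := R) l)) IHr.
suff -> : (fun f => \sum_(l <- l :: r) y l *: gen_op l f) =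
  y l \*: gen_op l \+ (fun f => \sum_(l <- r) y l *: gen_op l f) by [].
by apply/funext => f; rewrite big_cons.
Qed.

Lemma co_lin_op y f s k : co (lin_op y f) s k =
  if s is i :: s' then y (e_ i) * coS f s' k + y (f_ i) * co f s' k else 0.
Proof.
rewrite /lin_op co_sum; under eq_bigr do rewrite coZ co_lambda.
rewrite big_sumType /=.
case: s => [|i s]; first by rewrite !big1 ?addr0 // => j _; rewrite mulr0.
by congr (_ + _); rewrite (bigD1 i) //= eqxx big1 ?addr0 // => j /negbTE ->;
  rewrite mulr0.
Qed.

Lemma sumsqS n f : sumsq n.+1 f = \sum_(k < 1) absq (co f [::] k) +
  \sum_i \sum_(s <- words n) \sum_(k < (size s).+2) absq (co f (i :: s) k).
Proof. by rewrite /sumsq /= big_cons big_allpairs_dep big_enum. Qed.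

Lemma sum_coS f s : \sum_(k < (size s).+2) absq (coS f s k) =
  \sum_(k < (size s).+1) absq (co f s k).
Proof. by rewrite big_ord_recl /= absq0 add0r. Qed.

Lemma sum_co_recr f s : \sum_(k < (size s).+2) absq (co f s k) =
  \sum_(k < (size s).+1) absq (co f s k).
Proof. by rewrite big_ord_recr /= [co f s _.+1]/co ltnn absq0 addr0. Qed.

(** Sum the pointwise bound [sum_absqD_le] over all coordinates; the families
    [coS f] and [co f] have the same square sum. *)
Lemma lin_op_norm_le y : opnorm N (lin_op y) ^+ 2 <=
  \sum_i absq (y (e_ i)) + \sum_i absq (y (f_ i)) + 2 * Normc.normc (cross y).
Proof.
set K := Normc.normc (cross y); set A := \sum_i _; set B := \sum_i _.
have K0 : 0 <= K by exact: normc_ge0.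
have A0 : 0 <= A by apply: sumr_ge0 => i _; exact: absq_ge0.
have B0 : 0 <= B by apply: sumr_ge0 => i _; exact: absq_ge0.
have M0 : 0 <= A + B + 2 * K by rewrite !addr_ge0 // mulr_ge0.
rewrite -[leRHS]sqr_sqrtr // ler_pXn2r ?nnegrE ?sqrtr_ge0 //; last first.
  exact: ell2_opnorm_ge0 (Au_bounded (Au_lin_op y)).
apply: ell2_opnorm_le; rewrite ?sqrtr_ge0 // => f.
rewrite -(@ler_pXn2r _ 2) ?nnegrE ?mulr_ge0 ?ell2_norm_ge0 ?sqrtr_ge0 //.
rewrite exprMn (sqr_sqrtr M0); apply: ell2_sqnorm_le => -[|n].
  by rewrite /sumsq /= big_nil mulr_ge0 // sqr_ge0.
apply: (@le_trans _ _ ((A + B + 2 * K) * sumsq n f)); last first.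
  by rewrite ler_wpM2l ?sumsq_le.
rewrite sumsqS big_ord1 co_lin_op absq0 add0r exchange_big /= /sumsq mulr_sumr.
apply: ler_sum => s _; rewrite exchange_big /=.
under eq_bigr do under eq_bigr do rewrite co_lin_op.
apply: (@le_trans _ _ (\sum_(k < (size s).+2)
    ((A + K) * absq (coS f s k) + (B + K) * absq (co f s k)))).
  by apply: ler_sum => k _; exact: sum_absqD_le.
rewrite big_split /= -!mulr_sumr sum_coS sum_co_recr -mulrDl.
rewrite ler_wpM2r ?sumr_ge0 // => [k _|]; first exact: absq_ge0.
by lra.
Qed.

Definition const_word m : seq 'I_2 := nseq m ord0.

(** An approximate eigenvector of the shift in [k], for the eigenvalue [z], on
    words with a fixed long sequence of indices. *)
Definition test_vec z m : ell2 R :=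
  \sum_(k < m.+1) (conjc z) ^+ k *: xi R (pt k (const_word m)).

Lemma co_test_vec z m s k : co (test_vec z m) s k =
  if (s == const_word m) && (k <= m)%N then (conjc z) ^+ k else 0.
Proof.
rewrite /test_vec co_sum.
have E (j : 'I_m.+1) : co ((conjc z) ^+ j *: xi R (pt j (const_word m))) s k =
    (conjc z) ^+ j * ((s == const_word m) && (k == j))%:R.
  by rewrite coZ co_xi // size_nseq -ltnS.
under eq_bigr do rewrite E.
case: eqP => _ /=; last by rewrite big1 // => j _; rewrite mulr0.
case: leqP => km; last first.
  rewrite big1 // => j _; case: eqP => kj; last by rewrite mulr0.
  by move: (ltn_ord j); rewrite -kj ltnS leqNgt km.
rewrite (bigD1 (Ordinal (km : (k < m.+1)%N))) //= eqxx mulr1 big1 ?addr0 // => j.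
by rewrite -val_eqE /= eq_sym => /negbTE ->; rewrite mulr0.
Qed.

Lemma test_vec_norm z m : absq z = 1 -> N (test_vec z m) ^+ 2 <= m.+1%:R.
Proof.
move=> z1; apply: ell2_sqnorm_le => n; rewrite /sumsq.
have E s : \sum_(k < (size s).+1) absq (co (test_vec z m) s k) =
    if s == const_word m then m.+1%:R else 0.
  under eq_bigr do rewrite co_test_vec.
  case: eqP => [->|_] /=; last by rewrite big1 // => k _; rewrite absq0.
  rewrite size_nseq (eq_bigr (fun=> 1)) => [|k _].
    by rewrite sumr_const card_ord.
  by rewrite -ltnS ltn_ord absqX absqJ z1 expr1n.
under eq_bigr do rewrite E.
have [cw|cw] := boolP (const_word m \in words n).
  rewrite (bigD1_seq _ cw (words_uniq n)) /= eqxx big1 ?addr0 // => s.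
  by move=> /negbTE ->.
rewrite big_seq big1 // => s sw; case: eqP => // sc; move: cw.
by rewrite -sc sw.
Qed.

(** Of the [m + 2] coordinates of the image of [test_vec z m] at each new first
    index, [m] have modulus [|a_i z + b_i|], while the squared norm of the test
    vector is at most [m + 1].  Let [m] tend to infinity. *)
Lemma coef1_le S z : Au S -> absq z = 1 ->
  \sum_i absq (coef1 (e_ i) S * z + coef1 (f_ i) S) <= opnorm N S ^+ 2.
Proof.
move=> AS z1; set X := \sum_i _; set O := opnorm N S ^+ 2.
have tS := Au_triangular AS.
have zz : conjc z * z = 1 by rewrite mulrC mul_conj z1.
(* Letting [m] grow removes the factor [(m + 1) / m]. *)
suff h m : m%:R * X <= O * m.+1%:R.
  rewrite leNgt; apply/negP => OX.
  have OX0 : 0 < X - O by rewrite subr_gt0.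
  have := h (Num.truncn (O / (X - O))).+1.
  have := truncnS_gt (O / (X - O)); set n := (Num.truncn _).+1.
  by rewrite ltr_pdivrMr // -[n.+1]addn1 natrD => h1 h2; lra.
have vs : supp_ge (size (const_word m)) (test_vec z m).
  move=> s k sm; rewrite co_test_vec; case: eqP => // sc.
  by rewrite sc ltnn in sm.
have mid i (j : 'I_m) : absq (co (S (test_vec z m)) (i :: const_word m) j.+1) =
    absq (coef1 (e_ i) S * z + coef1 (f_ i) S).
  rewrite (tri_sub tS i _ vs) /coS !co_test_vec eqxx ltn_ord (ltnW (ltn_ord j)) /=.
  have -> : (i :: const_word m == const_word m) = false.
    apply/eqP => /(congr1 size); rewrite /= !size_nseq => /eqP.
    by rewrite eqn_leq ltnn.
  rewrite mulr0 add0r exprS.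
  have -> : coef1 (e_ i) S * conjc z ^+ j +
      coef1 (f_ i) S * (conjc z * conjc z ^+ j) =
     conjc z ^+ j.+1 * (coef1 (e_ i) S * z + coef1 (f_ i) S).
    rewrite exprS -[X in X * conjc z ^+ j + _]mulr1 -zz; ring.
  by rewrite absqM absqX absqJ z1 expr1n mul1r.
apply: (@le_trans _ _ (sumsq m.+2 (S (test_vec z m)))); last first.
  apply: le_trans (sumsq_le _ _) _.
  apply: (@le_trans _ _ (O * N (test_vec z m) ^+ 2)).
    rewrite /O -exprMn ler_pXn2r ?nnegrE ?mulr_ge0 ?ell2_norm_ge0 //.
      exact: ell2_opnormP (Au_bounded AS).
    exact: ell2_opnorm_ge0 (Au_bounded AS).
  by rewrite ler_wpM2l ?sqr_ge0 ?test_vec_norm.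
apply: (@le_trans _ _ (\sum_(s <- [seq i :: const_word m | i <- enum 'I_2])
    \sum_(k < (size s).+1) absq (co (S (test_vec z m)) s k))); last first.
  apply: (@sum_words_le R m.+2 _
      (fun s => \sum_(k < (size s).+1) absq (co (S (test_vec z m)) s k))).
  - by move=> s; apply: sumr_ge0 => k _; exact: absq_ge0.
  - by rewrite map_inj_uniq ?enum_uniq // => i j [].
  - by move=> _ /mapP[i _ ->]; rewrite mem_words /= size_nseq.
rewrite big_map big_enum /= mulr_sumr; apply: ler_sum => i _.
rewrite size_nseq big_ord_recl big_ord_recr /=.
rewrite (eq_bigr _ (fun j _ => mid i j)) sumr_const card_ord.
by rewrite mulr_natl addrCA lerDl addr_ge0 ?absq_ge0.
Qed.

End DegreeOneNorm.

(** * The two degree-one norms on C^4 are not isometric *)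

Section DegreeOneGeometry.
Variable R : realType.
Local Notation C := R[i].
Implicit Types (y g : letter -> C) (z t : C).

(** An element of degree one evaluated at a point of the circle: the pair [a, b]
    gives [a z + b]. *)
Definition value_at y z : 'I_2 -> C := fun i => y (e_ i) * z + y (f_ i).

Definition norm_e g : R := vnorm (fun i => g (e_ i)).
Definition norm_f g : R := vnorm (fun j => g (f_ j)).

(** Take for [z] the conjugate phase of [<a, b>]. *)
Lemma cross_phase y : exists2 z, absq z = 1 &
  \sum_i absq (value_at y z i) =
    \sum_i absq (y (e_ i)) + \sum_i absq (y (f_ i)) +
    2 * Normc.normc (cross y).
Proof.
have [c0|c0] := eqVneq (cross y) 0.
  exists 1; first exact: absq1.
  rewrite /value_at.
  under eq_bigr do rewrite -[y (f_ _)]mulr1.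
  by rewrite sum_absqD absq1 !mulr1 c0 mul0r Normc.normc0.
set k := Normc.normc (cross y).
have k0 : k != 0 by apply: contra c0 => /eqP/Normc.eq0_normc ->.
have kk : absq (cross y) = k ^+ 2 by rewrite -normc_sqr.
exists (Complex k^-1 0 * conjc (cross y)).
  rewrite absqM absqJ kk absq_real -exprMn mulVf //.
  by rewrite expr1n.
rewrite /value_at; under eq_bigr do rewrite -[y (f_ _)]mulr1.
rewrite sum_absqD absq1 !mulr1 conjc1 mulr1 absqM absqJ kk.
rewrite absq_real -exprMn mulVf // expr1n mulr1.
rewrite mulrCA mul_conj kk; simpc; congr (_ + 2 * _) => /=.
by rewrite expr2 mulKf.
Qed.

(** The squared norm of [s u - r v] plus [r s] times that of [u + v] is a
    positive combination of those of [u] and [v]; the hypotheses leave nothing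
    for the first term. *)
Lemma triangle_equality (u v : 'I_2 -> C) (r s : R) : 0 <= r -> 0 <= s ->
  \sum_i absq (u i) <= r ^+ 2 -> \sum_i absq (v i) <= s ^+ 2 ->
  (r + s) ^+ 2 <= \sum_i absq (u i + v i) ->
  forall i, Complex s 0 * u i = Complex r 0 * v i.
Proof.
move=> r0 s0 ur vs uvrs i; apply/eqP; rewrite -subr_eq0; apply/eqP/absq_eq0.
pose w i := Complex s 0 * u i - Complex r 0 * v i; rewrite -/(w i).
have E : \sum_i absq (w i) + r * s * (\sum_i absq (u i + v i)) =
    (s ^+ 2 + r * s) * (\sum_i absq (u i)) + (r ^+ 2 + r * s) * (\sum_i absq (v i)).
  rewrite !mulr_sumr -!big_split /=; apply: eq_bigr => j _; rewrite /w.
  by case: (u j) (v j) => a b [a' b']; rewrite /absq /=; ring.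
have W : \sum_i absq (w i) <= 0.
  have rs0 : 0 <= r * s by rewrite mulr_ge0.
  have h1 : (s ^+ 2 + r * s) * (\sum_i absq (u i)) <= (s ^+ 2 + r * s) * r ^+ 2.
    by rewrite ler_wpM2l // addr_ge0 ?sqr_ge0.
  have h2 : (r ^+ 2 + r * s) * (\sum_i absq (v i)) <= (r ^+ 2 + r * s) * s ^+ 2.
    by rewrite ler_wpM2l // addr_ge0 ?sqr_ge0.
  have h3 := ler_wpM2l rs0 uvrs; lra.
apply/eqP; rewrite eq_le absq_ge0 andbT; apply: le_trans W.
by rewrite (bigD1 i) //= lerDl sumr_ge0 // => j _; exact: absq_ge0.
Qed.

(** The determinant of the matrix with columns [a] and [b], and below its polar
    form. *)
Definition det_ef y : C :=
  y (e_ ord0) * y (f_ ord_max) - y (e_ ord_max) * y (f_ ord0).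

Definition pol_ef y y' : C :=
  y (e_ ord0) * y' (f_ ord_max) + y' (e_ ord0) * y (f_ ord_max)
  - y (e_ ord_max) * y' (f_ ord0) - y' (e_ ord_max) * y (f_ ord0).

Variable L : (letter -> C) -> letter -> C.
Hypothesis L_linear : forall t g g' l,
  L (fun l => t * g l + g' l) l = t * L g l + L g' l.
Hypothesis L_le : forall g z, absq z = 1 ->
  \sum_i absq (value_at (L g) z i) <= (norm_e g + norm_f g) ^+ 2.
Hypothesis L_ge : forall g, exists2 z, absq z = 1 &
  (norm_e g + norm_f g) ^+ 2 <= \sum_i absq (value_at (L g) z i).

Definition e_part g : letter -> C := fun l => if l is inl _ then g l else 0.
Definition f_part g : letter -> C := fun l => if l is inr _ then g l else 0.

Lemma vnorm_scale t (v : 'I_2 -> C) :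
  absq t = 1 -> vnorm (fun i => t * v i) = vnorm v.
Proof.
by move=> t1; rewrite /vnorm; under eq_bigr do rewrite absqM t1 mul1r.
Qed.

(** Expansion of the determinant of [s p - r t q], where [s] and [r] are the
    norms of the [f] part and the [e] part: at the point [z] where the norm of
    [p + t q] is attained, this matrix maps [(z, 1)] to zero. *)
Lemma det_e_f_part g t : absq t = 1 ->
  let p := L (e_part g) in let q := L (f_part g) in
  (Complex (norm_f g) 0) ^+ 2 * det_ef p -
  Complex (norm_f g) 0 * Complex (norm_e g) 0 * t * pol_ef p q +
  (Complex (norm_e g) 0) ^+ 2 * t ^+ 2 * det_ef q = 0.
Proof.
move=> t1 p q.
have v0 : vnorm (fun=> 0 : C) = 0.
  by rewrite /vnorm big1 ?sqrtr0 // => i _; rewrite absq0.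
pose g' l := t * f_part g l + e_part g l.
have eg' : norm_e g' = norm_e g.
  by congr vnorm; apply/funext => i; rewrite /g' /f_part /e_part /= mulr0 add0r.
have fg' : norm_f g' = norm_f g.
  rewrite -[RHS](vnorm_scale _ t1); congr vnorm.
  by apply/funext => i; rewrite /g' /f_part /e_part /= addr0.
have [z z1] := L_ge g'; rewrite eg' fg' => zge.
have [pz qz] : \sum_i absq (value_at p z i) <= norm_e g ^+ 2 /\
    \sum_i absq (t * value_at q z i) <= norm_f g ^+ 2.
  split; first by have := L_le (e_part g) z1; rewrite /norm_f /f_part /= v0 addr0.
  under eq_bigr do rewrite absqM t1 mul1r.
  by have := L_le (f_part g) z1; rewrite /norm_e /f_part /= v0 add0r.
have gz i : value_at (L g') z i = value_at p z i + t * value_at q z i.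
  by rewrite /value_at !L_linear -/p -/q; ring.
rewrite (eq_bigr _ (fun i _ => congr1 (@absq R) (gz i))) in zge.
have H i : Complex (norm_f g) 0 * value_at p z i =
    Complex (norm_e g) 0 * (t * value_at q z i).
  exact: (triangle_equality (vnorm_ge0 _) (vnorm_ge0 _) pz qz zge).
have := H ord0; have := H ord_max; rewrite /value_at /det_ef /pol_ef.
move: (Complex (norm_f g) 0) (Complex (norm_e g) 0) => s r.
move: (p (e_ ord0)) (p (f_ ord0)) (p (e_ ord_max)) (p (f_ ord_max)).
move: (q (e_ ord0)) (q (f_ ord0)) (q (e_ ord_max)) (q (f_ ord_max)).
move=> a0 b0 a1 b1 c0 d0 c1 d1 H1 H0.
have F0 : s * d0 - r * t * b0 = - z * (s * c0 - r * t * a0).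
  apply/eqP; rewrite -subr_eq0; apply/eqP.
  by move/eqP: H0; rewrite -subr_eq0 => /eqP <-; ring.
have F1 : s * d1 - r * t * b1 = - z * (s * c1 - r * t * a1).
  apply/eqP; rewrite -subr_eq0; apply/eqP.
  by move/eqP: H1; rewrite -subr_eq0 => /eqP <-; ring.
(* Both sides are the determinant of [s p - r t q], whose columns are
   proportional by [F0] and [F1]. *)
transitivity ((s * c0 - r * t * a0) * (s * d1 - r * t * b1) -
   (s * c1 - r * t * a1) * (s * d0 - r * t * b0)); first by ring.
by rewrite F0 F1; ring.
Qed.

(** The values [t = 1, -1, i] separate the three terms. *)
Lemma det_e_f_part0 g : let p := L (e_part g) in let q := L (f_part g) in
  [/\ (Complex (norm_f g) 0) ^+ 2 * det_ef p = 0,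
      (Complex (norm_e g) 0) ^+ 2 * det_ef q = 0 &
      Complex (norm_f g) 0 * Complex (norm_e g) 0 * pol_ef p q = 0].
Proof.
move=> p q.
have one := absq1 R.
have oneN : absq (-1 : C) = 1 by rewrite absqN.
have onei : absq (Complex 0 1 : C) = 1 by rewrite /absq /= expr1n expr0n add0r.
have := det_e_f_part g one; have := det_e_f_part g oneN.
have := det_e_f_part g onei; rewrite -/p -/q /=.
have -> : (Complex 0 1 : C) ^+ 2 = -1 by rewrite sqr_i.
move: (Complex (norm_f g) 0) (Complex (norm_e g) 0) (Complex 0 1 : C) => s r i.
move: (det_ef p) (det_ef q) (pol_ef p q) => A B P h1 h2 h3.
have two : (2 : C) != 0 by rewrite pnatr_eq0.
have E1 : s * r * P = 0.
  apply: (mulfI two); rewrite mulr0 -[RHS](subrr 0) -{1}h2 -h3; ring.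
have E2 : s ^+ 2 * A + r ^+ 2 * B = 0.
  apply: (mulfI two); rewrite mulr0 -[RHS](addr0 0) -{1}h2 -h3; ring.
have E3 : s ^+ 2 * A - r ^+ 2 * B = 0.
  by rewrite -h1 -[s * r * i * P]mulrA [i * P]mulrC mulrA E1; ring.
split=> //; apply: (mulfI two); rewrite mulr0.
  by rewrite -[RHS](addr0 0) -{1}E2 -E3; ring.
by rewrite -[RHS](subrr 0) -{1}E2 -E3; ring.
Qed.

Lemma vnorm_eq0 (v : 'I_2 -> C) : vnorm v = 0 -> forall i, v i = 0.
Proof.
move=> v0 i; apply: absq_eq0; apply/eqP; rewrite eq_le absq_ge0 andbT.
have : \sum_i absq (v i) <= 0 by rewrite -vnorm_sqr v0 expr0n.
apply: le_trans; rewrite (bigD1 i) //= lerDl sumr_ge0 // => j _; exact: absq_ge0.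
Qed.

(** The determinants of [p] and of [q] vanish in all cases, since either part of
    [g] can be completed by an arbitrary nonzero vector in the other part. *)
Lemma det_ef_L g : det_ef (L g) = 0.
Proof.
set p := L (e_part g); set q := L (f_part g).
have C0 (x : R) : x != 0 -> (Complex x 0 : C) != 0.
  by apply: contra => /eqP[->].
have n1 : vnorm (fun=> 1 : C) != 0.
  apply/eqP => /vnorm_eq0/(_ ord0)/eqP; by rewrite oner_eq0.
have dp : det_ef p = 0.
  pose g1 (l : letter) : C := if l is inl _ then g l else 1.
  have ep : e_part g1 = e_part g by apply/funext => -[].
  have [/eqP + _ _] := det_e_f_part0 g1; rewrite ep mulf_eq0 expf_eq0 /=.
  by rewrite (negbTE (C0 _ n1)) => /eqP.
have dq : det_ef q = 0.
  pose g1 (l : letter) : C := if l is inl _ then 1 else g l.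
  have fp : f_part g1 = f_part g by apply/funext => -[].
  have [_ /eqP + _] := det_e_f_part0 g1; rewrite fp mulf_eq0 expf_eq0 /=.
  by rewrite (negbTE (C0 _ n1)) => /eqP.
have L0 g' : (forall l, g' l = 0) -> forall l, L g' l = 0.
  move=> g0 l; have -> : g' = (fun l => -1 * g' l + g' l).
    by apply/funext => l'; rewrite g0 mulr0 addr0.
  by rewrite L_linear mulN1r addNr.
have pq : pol_ef p q = 0.
  have [_ _ /eqP] := det_e_f_part0 g; rewrite -/p -/q !mulf_eq0.
  move=> /orP[/orP[]|/eqP //].
    have [n0 _|/C0/negbTE -> //] := eqVneq (norm_f g) 0.
    have q0 l : q l = 0 by apply: L0 => -[] // j; exact: (vnorm_eq0 n0 j).
    by rewrite /pol_ef !q0 !mulr0 !mul0r; ring.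
  have [n0 _|/C0/negbTE -> //] := eqVneq (norm_e g) 0.
  have p0 l : p l = 0 by apply: L0 => -[] // j; exact: (vnorm_eq0 n0 j).
  by rewrite /pol_ef !p0 !mulr0 !mul0r; ring.
have -> : det_ef (L g) = det_ef p + det_ef q + pol_ef p q.
  have E l : L g l = p l + q l.
    have {1}-> : g = (fun l => 1 * e_part g l + f_part g l).
      by apply/funext => -[] j; rewrite /= mul1r ?addr0 ?add0r.
    by rewrite L_linear mul1r.
  by rewrite /det_ef /pol_ef !E; ring.
by rewrite dp dq pq !addr0.
Qed.

End DegreeOneGeometry.

(** * An isometric isomorphism respects degree one *)

(** Row rank equals column rank, so that a trivial left kernel makes a square
    system solvable from the right; rows and columns are indexed by an
    arbitrary finite type. *)
Lemma finite_inverse (F : fieldType) (I : finType) (m : I -> I -> F) :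
  (forall c : I -> F, (forall l, \sum_k c k * m k l = 0) -> forall k, c k = 0) ->
  exists n : I -> I -> F,
    (forall (x g : I -> F), (forall k, \sum_l m k l * x l = g k) ->
       forall l, x l = \sum_k n l k * g k).
Proof.
move=> m_free; pose A := \matrix_(i < #|I|, j < #|I|) m (enum_val i) (enum_val j).
have sumI (G : I -> F) : \sum_l G l = \sum_(i < #|I|) G (enum_val i).
  by rewrite (reindex (@enum_val I I)) //; apply/onW_bij/enum_val_bij.
have uA : A \in unitmx.
  rewrite -row_free_unit -kermx_eq0; apply/eqP/row_matrixP => i; rewrite row0.
  apply/rowP => j; rewrite mxE.
  have kA : row i (kermx A) *m A = 0.
    by apply/sub_kermxP; exact: row_sub.
  have := m_free (fun k => row i (kermx A) 0 (enum_rank k)) _ (enum_val j).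
  rewrite enum_valK !mxE; apply=> l; rewrite sumI.
  transitivity ((row i (kermx A) *m A) 0 (enum_rank l)); last by rewrite kA mxE.
  by rewrite mxE; apply: eq_bigr => k _; rewrite !mxE enum_valK enum_rankK.
exists (fun l k => invmx A (enum_rank l) (enum_rank k)) => x g xg l.
have Ax : A *m (\col_i x (enum_val i)) = \col_i g (enum_val i).
  apply/colP => i; rewrite !mxE -xg sumI; apply: eq_bigr => j _.
  by rewrite !mxE.
have := congr1 (mulmx (invmx A)) Ax; rewrite mulKmx // => /colP/(_ (enum_rank l)).
rewrite !mxE enum_rankK => ->; rewrite sumI.
by apply: eq_bigr => j _; rewrite !mxE enum_valK.
Qed.

Section Isomorphism.
Variables (R : realType) (Phi : (ell2 R -> ell2 R) -> tensor_algebra R).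
Hypothesis PhiP : isometric_isomorphism Phi.
Implicit Types (S T : ell2 R -> ell2 R) (c : R[i]) (l k : letter).
Local Notation N := (@ell2_norm R).
Local Notation AuP := (Au_closed_unital_algebra R).

Definition psi S : R[i] := taugm (Phi S).
Definition der k S : R[i] := tlin k (Phi S).

Lemma PhiD S T : Au S -> Au T -> Phi (S \+ T) = Phi S + Phi T.
Proof. by case: PhiP => + _ _ _ _; apply. Qed.

Lemma PhiZ c S : Au S -> Phi (c \*: S) = c *: Phi S.
Proof. by case: PhiP => _ + _ _ _; apply. Qed.

Lemma PhiM S T : Au S -> Au T -> Phi (S \o T) = Phi S * Phi T.
Proof. by case: PhiP => _ _ + _ _; apply. Qed.

Lemma Phi_norm S : Au S -> tensor_norm (Phi S) = opnorm N S.
Proof. by case: PhiP => _ _ _ + _; apply. Qed.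

Lemma Phi_surj t : exists2 S, Au S & Phi S = t.
Proof. by case: PhiP => _ _ _ _ +; apply. Qed.

Lemma PhiB S T : Au S -> Au T -> Phi (S \- T) = Phi S - Phi T.
Proof.
move=> AS AT; have -> : S \- T = S \+ (-1) \*: T.
  by apply/funext => f; rewrite /= scaleN1r.
by rewrite PhiD ?PhiZ ?scaleN1r //; exact: (cua_scale AuP).
Qed.

Lemma psi_functional : Au_functional psi.
Proof.
split=> [S T AS AT|].
  by rewrite /psi PhiB // -scaleN1r taugmD taugmZ mulN1r.
exists 1 => S AS; rewrite mul1r -Phi_norm //.
rewrite -(@ler_pXn2r _ 2) ?nnegrE ?normc_ge0 ?tensor_norm_ge0 //.
by rewrite normc_sqr taugm_le.
Qed.

Lemma der_functional k : Au_functional (der k).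
Proof.
split=> [S T AS AT|].
  by rewrite /der PhiB // -scaleN1r tlinD tlinZ mulN1r.
exists 1 => S AS; rewrite mul1r -Phi_norm //.
rewrite -(@ler_pXn2r _ 2) ?nnegrE ?normc_ge0 ?tensor_norm_ge0 //.
by rewrite normc_sqr tlin_le.
Qed.

Lemma psiM S T : Au S -> Au T -> psi (S \o T) = psi S * psi T.
Proof. by move=> AS AT; rewrite /psi PhiM // (taugm_tlinM (e_ ord0) _ _).1. Qed.

Lemma derM k S T : Au S -> Au T ->
  der k (S \o T) = psi S * der k T + der k S * psi T.
Proof. by move=> AS AT; rewrite /der PhiM // (taugm_tlinM k _ _).2. Qed.

Lemma psiD S T : Au S -> Au T -> psi (S \+ T) = psi S + psi T.
Proof. by move=> AS AT; rewrite /psi PhiD // taugmD. Qed.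

Lemma derD k S T : Au S -> Au T -> der k (S \+ T) = der k S + der k T.
Proof. by move=> AS AT; rewrite /der PhiD // tlinD. Qed.

Lemma psiZ c S : Au S -> psi (c \*: S) = c * psi S.
Proof. by move=> AS; rewrite /psi PhiZ // taugmZ. Qed.

Lemma derZ k c S : Au S -> der k (c \*: S) = c * der k S.
Proof. by move=> AS; rewrite /der PhiZ // tlinZ. Qed.

Lemma der_surj (g : letter -> R[i]) :
  exists2 S, Au S /\ Phi S = tlin_elt g & forall k, der k S = g k.
Proof.
have [S AS PS] := Phi_surj (tlin_elt g); exists S => // k.
by rewrite /der PS tlin_tlin_elt.
Qed.

(** Otherwise [psi] is zero, hence so are all derivations at [psi], against
    surjectivity. *)
Lemma psi_id : psi idfun = 1.
Proof.
have Aid := cua_id AuP.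
have : psi idfun * psi idfun = psi idfun by rewrite -psiM.
have [p0|p0 pp] := eqVneq (psi idfun) 0; last first.
  by apply: (mulfI p0); rewrite mulr1.
have ps S : Au S -> psi S = 0.
  by move=> AS; rewrite -[S]/(idfun \o S) psiM // p0 mul0r.
have [S [AS _] /(_ (e_ ord0))] := der_surj (fun=> 1).
rewrite -[S]/(idfun \o S) derM // p0 ps // mul0r mulr0 addr0 => /eqP.
by rewrite eq_sym oner_eq0.
Qed.

Lemma der_id k : der k idfun = 0.
Proof.
have Aid := cua_id AuP.
have : der k idfun = psi idfun * der k idfun + der k idfun * psi idfun :=
  derM k Aid Aid.
rewrite psi_id mul1r mulr1.
by move/eqP; rewrite -subr_eq0 opprD addrA subrr add0r oppr_eq0 => /eqP.
Qed.

(** A combination that vanishes on the generators is a derivation vanishing on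
    all of [Au], while [Phi] is onto and the degree-one coefficients are
    independent on the tensor algebra. *)
Lemma der_gen_free (c : letter -> R[i]) :
  (forall l, \sum_k c k * der k (gen_op l) = 0) -> forall k, c k = 0.
Proof.
move=> c0; pose E S := \sum_k c k * der k S.
have bE : Au_functional E.
  apply: Au_functional_sum => k.
  have [FB [K FK]] := Au_functionalZ (c k) (der_functional k).
  split=> [S T AS AT|]; first by rewrite mulrC FB // ![c k * _]mulrC.
  by exists K => S AS; rewrite mulrC FK.
have E0 S : Au S -> E S = 0.
  move: S; apply: Au_ind => //.
  - by rewrite /E big1 // => k _; rewrite der_id mulr0.
  - move=> S T AS AT ES ET; rewrite -[0]addr0 -{1}ES -ET /E -big_split /=.
    by apply: eq_bigr => k _; rewrite derD // mulrDr.
  - move=> a S AS ES; rewrite -(mulr0 a) -ES /E mulr_sumr.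
    by apply: eq_bigr => k _; rewrite derZ // mulrCA.
  - move=> S T AS AT ES ET.
    have -> : E (S \o T) = psi S * E T + E S * psi T.
      rewrite /E mulr_sumr mulr_suml -big_split /=; apply: eq_bigr => k _.
      by rewrite derM //; ring.
    by rewrite ES ET mulr0 mul0r addr0.
  - by move=> T AT clT; exact: (Au_functional_limit bE AT clT).
move=> k; have [S [AS _] Sk] := der_surj (fun l => (l == k)%:R).
have := E0 S AS; rewrite /E (bigD1 k) //= Sk eqxx mulr1.
rewrite big1 ?addr0 // => l /negbTE lk.
by rewrite Sk lk mulr0.
Qed.

Lemma gen_op_flip i j : gen_op (e_ i) \o gen_op (f_ j) =
  gen_op (f_ i) \o gen_op (e_ j) :> (ell2 R -> ell2 R).
Proof.
rewrite /gen_op -!lambda_mul !mulF_cls.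
suff /clsP -> : flip_cong ([:: e_ i] ++ [:: f_ j]) ([:: f_ i] ++ [:: e_ j]) by [].
exact: flip_rel.
Qed.

(** Apply the derivations to [e_1 f_2 = f_1 e_2]: the vector of the values of
    [psi] on the generators, permuted and signed, is in the right kernel of
    the matrix of [der_gen_free]. *)
Lemma psi_gen l : psi (gen_op l) = 0.
Proof.
have Ag := Au_gen (R := R); have [n nP] := finite_inverse der_gen_free.
(* The coefficients of the hyperplane that contains the values on the
   generators of every derivation at [psi]. *)
pose r (l : letter) : R[i] := match l with
  | inl i =>
      if i == ord0 then psi (gen_op (f_ ord_max)) else - psi (gen_op (f_ ord0))
  | inr j =>
      if j == ord0 then - psi (gen_op (e_ ord_max)) else psi (gen_op (e_ ord0))
  end.
have r0 l' : r l' = 0.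
  rewrite (nP r (fun=> 0)) ?big1 // => [k _|k]; first by rewrite mulr0.
  have := congr1 (der k) (gen_op_flip ord0 ord_max).
  rewrite !derM // big_sumType /= !big_ord_recl !big_ord0 /=.
  have -> : lift ord0 ord0 = ord_max :> 'I_2 by exact: val_inj.
  move=> /eqP; rewrite -subr_eq0 => /eqP h; rewrite -[RHS]h; ring.
case: l => -[[|[|//]] p].
- have := r0 (f_ ord_max); rewrite /=.
  by have -> : Ordinal p = ord0 by exact: val_inj.
- have := r0 (f_ ord0) => /= /eqP; rewrite oppr_eq0 => /eqP.
  by have -> : Ordinal p = ord_max by exact: val_inj.
- have := r0 (e_ ord_max) => /= /eqP; rewrite oppr_eq0 => /eqP.
  by have -> : Ordinal p = ord0 by exact: val_inj.
- have := r0 (e_ ord0); rewrite /=.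
  by have -> : Ordinal p = ord_max by exact: val_inj.
Qed.

(** Both sides are bounded, agree on the generators and are respectively
    characters and derivations. *)
Lemma psi_der_coef S : Au S -> psi S = coef0 S /\
  forall k, der k S = \sum_l der k (gen_op l) * coef1 l S.
Proof.
move: S; apply: Au_ind.
- rewrite psi_id coef0_id; split=> // k; rewrite der_id big1 // => l _.
  by rewrite coef1_id mulr0.
- move=> l; rewrite psi_gen coef0_gen; split=> // k.
  rewrite (bigD1 l) //= coef1_gen eqxx mulr1 big1 ?addr0 // => l' /negbTE ll'.
  by rewrite coef1_gen ll' mulr0.
- move=> S T AS AT [pS dS] [pT dT]; rewrite psiD // pS pT coef0D; split=> // k.
  rewrite derD // dS dT -big_split; apply: eq_bigr => l _.
  by rewrite coef1D mulrDr.
- move=> c S AS [pS dS]; rewrite psiZ // pS coef0Z; split=> // k.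
  rewrite derZ // dS mulr_sumr; apply: eq_bigr => l _.
  by rewrite coef1Z mulrCA.
- move=> S T AS AT [pS dS] [pT dT]; have tS := Au_triangular AS.
  rewrite psiM // pS pT (coef0M T tS); split=> // k.
  rewrite derM // pS pT dS dT mulr_sumr mulr_suml -big_split.
  by apply: eq_bigr => l _; rewrite (coef1M l T tS) /=; ring.
- move=> T AT clT; split=> [|k].
    apply/eqP; rewrite -subr_eq0; apply/eqP.
    have bp := Au_functionalB psi_functional (Au_functional_co (vac R) [::] 0).
    apply: (Au_functional_limit bp AT).
    by move=> e /clT[S [AS [pS _] Se]]; exists S; split=> //; rewrite pS subrr.
  apply/eqP; rewrite -subr_eq0; apply/eqP.
  have bs : Au_functional (fun S => \sum_l coef1 l S * der k (gen_op l)).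
    by apply: Au_functional_sum => l; apply: Au_functionalZ; exact: Au_functional_co.
  under eq_bigr do rewrite mulrC.
  apply: (Au_functional_limit (Au_functionalB (der_functional k) bs) AT).
  move=> e /clT[S [AS [_ dS] Se]]; exists S; split=> //; rewrite dS.
  by under eq_bigr do rewrite mulrC; rewrite subrr.
Qed.

Lemma coef1_lin_op (y : letter -> R[i]) l : coef1 l (lin_op y) = y l.
Proof.
rewrite /coef1 co_lin_op /coS; case: l => i /=; rewrite !co_vac /=.
  by rewrite mulr1 mulr0 addr0.
by rewrite mulr0 mulr1 add0r.
Qed.

(** [L] is the inverse of the matrix of derivations on the generators, hence a
    linear isometry from the degree-one norm of the tensor algebra to that of
    [Au].  Its range contains the identity matrix, of determinant 1. *)
Lemma no_isometric_isomorphism : False.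
Proof.
have [n nP] := finite_inverse der_gen_free.
pose L (g : letter -> R[i]) l := \sum_k n l k * g k.
have L_linear t g g' l : L (fun l => t * g l + g' l) l = t * L g l + L g' l.
  rewrite /L mulr_sumr -big_split; apply: eq_bigr => k _ /=; ring.
have sqr0 g : 0 <= norm_e g + norm_f g by rewrite addr_ge0 ?vnorm_ge0.
have L_le g z : absq z = 1 ->
    \sum_i absq (value_at (L g) z i) <= (norm_e g + norm_f g) ^+ 2.
  move=> z1; have [S [AS PS] dS] := der_surj g.
  have LS l : L g l = coef1 l S.
    rewrite (nP _ _ (fun k => esym ((psi_der_coef AS).2 k))) /L.
    by apply: eq_bigr => k _; rewrite dS.
  apply: le_trans (_ : opnorm N S ^+ 2 <= _).
    by under eq_bigr do rewrite /value_at !LS; exact: coef1_le.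
  have O0 : 0 <= opnorm N S by rewrite -Phi_norm // tensor_norm_ge0.
  by rewrite ler_pXn2r ?nnegrE ?sqr0 // -Phi_norm // PS tensor_norm_tlin_elt.
have m_L g k : \sum_l der k (gen_op l) * L g l = g k.
  have [S [AS PS] dS] := der_surj g.
  rewrite -dS (psi_der_coef AS).2; apply: eq_bigr => l _; congr (_ * _).
  rewrite (nP _ _ (fun k => esym ((psi_der_coef AS).2 k))) /L.
  by apply: eq_bigr => k' _; rewrite dS.
have L_ge g : exists2 z, absq z = 1 &
    (norm_e g + norm_f g) ^+ 2 <= \sum_i absq (value_at (L g) z i).
  have [z z1 zE] := cross_phase (L g); exists z => //; rewrite zE.
  apply: le_trans (lin_op_norm_le (L g)).
  have AL := Au_lin_op (L g).
  have O0 : 0 <= opnorm N (lin_op (L g)) by rewrite -Phi_norm // tensor_norm_ge0.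
  rewrite ler_pXn2r ?nnegrE ?sqr0 // -Phi_norm //.
  apply: le_trans (tlin_vnorm_le _).
  have dL k : tlin k (Phi (lin_op (L g))) = g k.
    rewrite -/(der k _) (psi_der_coef AL).2 -[RHS]m_L; apply: eq_bigr => l _.
    by rewrite coef1_lin_op.
  have Ee : (fun i => tlin (e_ i) (Phi (lin_op (L g)))) = (fun i => g (e_ i)).
    by apply/funext => i.
  have Ef : (fun j => tlin (f_ j) (Phi (lin_op (L g)))) = (fun j => g (f_ j)).
    by apply/funext => j.
  by rewrite Ee Ef.
pose y (l : letter) : R[i] := ((l == e_ ord0) || (l == f_ ord_max))%:R.
have Ly l : L (fun k => \sum_l der k (gen_op l) * y l) l = y l.
  exact: esym (nP y _ (fun=> erefl) l).
have := det_ef_L L_linear L_le L_ge (fun k => \sum_l der k (gen_op l) * y l).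
rewrite /det_ef !Ly /y /= mulr1 mul0r subr0 => /eqP.
by rewrite oner_eq0.
Qed.

End Isomorphism.

Theorem mainTheorem6 (R : realType) :
  ~ exists Phi : (ell2 R -> ell2 R) -> tensor_algebra R,
      isometric_isomorphism Phi.
Proof. by move=> [Phi]; exact: no_isometric_isomorphism. Qed.
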